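(* Let $\mathcal{U}$ be the family of finite simple graphs $\mathcal{G}(S)$ with $S$ an unsatisfiable simple 2-CNF. Let $M$ be the set consisting of the following four graphs: (1) the ''butterfly'': two triangles sharing exactly one vertex (5 vertices, 6 edges); (2) the ''bowtie'': two vertex-disjoint triangles together with one edge joining a vertex of the first triangle to a vertex of the second (6 vertices, 7 edges); (3) the complete graph $K_4$; (4) the complete tripartite graph $K_{1,1,3}$ (two adjacent vertices $x,y$ and three further vertices each adjacent to both $x$ and $y$; 5 vertices, 7 edges). Then $M$ is the complete set of minimal unsatisfiability graphs. In particular, a simple graph $G$ belongs to $\mathcal{U}$ if and only if some element of $M$ is a topological minor of $G$, and every element of $M$ is a minimal unsatisfiability graph.
   Context: Let $V$ be a finite set of Boolean variables, $\neg V=\{\neg x: x\in V\}$, and let $\top,\bot$ denote True and False. Literals are elements of $V\cup\neg V\cup\{\top,\bot\}$. A clause is a disjunction of literals; a CNF is a conjunction of one or more clauses. A CNF (or clause) is reduced if it is unchanged under the rewriting rules $x\vee\top=\top$, $x\vee\bot=x$, $x\wedge\top=x$, $x\wedge\bot=\bot$, $x\vee x=x$, $x\wedge x=x$, $\neg\neg x=x$, $x\vee\neg x=\top$. The length of a reduced clause is its number of literals; a reduced 2-CNF is a reduced CNF all of whose clauses have length 2 (the CNFs $\top$ and $\bot$ also count as 2-CNFs). A reduced CNF is nontrivial if it is neither $\top$ nor $\bot$, and satisfiable if some truth assignment to the variables makes it true. For $x\in V$ write $|x|=|\neg x|=x$. To a nontrivial reduced 2-CNF $S=\bigwedge_j (a_j\vee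 b_j)$ one associates the multigraph whose vertex set is the set of variables occurring in $S$ and which has one edge $\{|a_j|,|b_j|\}$ for each clause; $S$ is supported on this multigraph. $S$ is simple if this multigraph has no multiple edges, in which case it is a simple graph denoted $\mathcal{G}(S)$. A graph $G$ is a topological minor of $H$ if some subdivision of $G$ (obtained by repeatedly replacing an edge $(u,v)$ by a path $u,w,v$ through a new vertex $w$) is isomorphic to a subgraph of $H$. A graph $G$ is a minimal unsatisfiability graph if $G\in\mathcal{U}$ and no proper topological minor of $G$ lies in $\mathcal{U}$. A set $M$ of minimal unsatisfiability graphs is complete if every graph in $\mathcal{U}$ has some element of $M$ as a topological minor. All graphs are finite and simple.
   Formalization: The ''if and only if'' is stated with the added condition that G has no isolated vertex, since vertices of G(S) are variables occurring in S; e.g. the butterfly plus an isolated vertex has an element of M as a topological minor but is not in U. *)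

(* Defs.v *)
From HB Require Import structures.
From mathcomp Require Import all_boot.

Set Implicit Arguments.
Unset Strict Implicit.
Unset Printing Implicit Defensive.

(** * Finite simple graphs *)

Record sgraph := SGraph {
  vertex :> finType;
  adj : rel vertex;
  adj_sym : symmetric adj;
  adj_irr : irreflexive adj }.

Definition graph_iso (G H : sgraph) : Prop :=
  exists2 f : G -> H, bijective f & forall x y, adj (f x) (f y) = adj x y.

(* [f] identifies [G] with the subgraph of [H] whose vertices and edges are the
   images of those of [G]; the subgraph need not be induced. *)
Definition iso_to_subgraph (G H : sgraph) : Prop :=
  exists2 f : G -> H, injective f & forall x y, adj x y -> adj (f x) (f y).

Definition no_isolated_vertex (G : sgraph) : Prop :=
  forall x : G, exists y : G, adj x y.

Section SubdivideEdge.
Variables (G : sgraph) (u v : G).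

(* [None] is the new vertex [w]. *)
Definition subdiv_adj (a b : option G) : bool :=
  match a, b with
  | Some x, Some y => adj x y && ([set x; y] != [set u; v])
  | Some x, None | None, Some x => x \in [set u; v]
  | None, None => false
  end.

Fact subdiv_adj_sym : symmetric subdiv_adj.
Proof. by move=> [x|] [y|] //=; rewrite adj_sym setUC. Qed.

Fact subdiv_adj_irr : irreflexive subdiv_adj.
Proof. by move=> [x|] //=; rewrite adj_irr. Qed.

Definition subdivide_edge : sgraph :=
  @SGraph (option G) subdiv_adj subdiv_adj_sym subdiv_adj_irr.

End SubdivideEdge.

Inductive subdivision (G : sgraph) : sgraph -> Prop :=
| subdivision_refl : subdivision G G
| subdivision_step (H : sgraph) (u v : H) :
    subdivision G H -> adj u v -> subdivision G (subdivide_edge u v).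

Definition topological_minor (G H : sgraph) : Prop :=
  exists2 G' : sgraph, subdivision G G' & iso_to_subgraph G' H.

Definition proper_topological_minor (G H : sgraph) : Prop :=
  topological_minor G H /\ ~ graph_iso G H.

(** * CNFs *)

Inductive literal (V : Type) : Type :=
  Pos of V | Neg of V | Top | Bot.
Arguments Top {V}.
Arguments Bot {V}.

Section LiteralEq.
Variable V : eqType.

Definition literal_code (l : literal V) : V + V + bool :=
  match l with
  | Pos x => inl (inl x) | Neg x => inl (inr x)
  | Top => inr true | Bot => inr false
  end.

Definition literal_decode (s : V + V + bool) : literal V :=
  match s with
  | inl (inl x) => Pos x | inl (inr x) => Neg x
  | inr true => Top | inr false => Bot
  end.

Fact literal_codeK : cancel literal_code literal_decode.
Proof. by case. Qed.

HB.instance Definition _ := Equality.copy (literal V) (can_type literal_codeK).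

End LiteralEq.

(* A clause is the disjunction of its list of literals, a CNF the conjunction
   of its list of clauses.  The formulas True and False are [:: [:: Top]] and
   [:: [:: Bot]]. *)
Definition clause (V : Type) := seq (literal V).
Definition cnf (V : Type) := seq (clause V).

Section CNF.
Variable V : finType.
Implicit Types (l : literal V) (c d : clause V) (S F : cnf V).

(* Negation of literals is computed, so the rule ~~x = x is built in. *)
Definition lneg l : literal V :=
  match l with
  | Pos x => Neg x | Neg x => Pos x | Top => Bot | Bot => Top
  end.

Definition wf_cnf S : bool := (S != [::]) && all (fun c => c != [::]) S.

(* One application of a rewriting rule, modulo associativity and commutativity
   of the connectives. *)
Inductive clause_step : clause V -> clause V -> Prop :=
| or_top c d : d != [::] -> perm_eq c (Top :: d) -> clause_step c [:: Top]
| or_bot c d : d != [::] -> perm_eq c (Bot :: d) -> clause_step c d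
| or_idem c d l : perm_eq c [:: l, l & d] -> clause_step c (l :: d)
| or_compl c d l : perm_eq c [:: l, lneg l & d] -> clause_step c (Top :: d).

Inductive cnf_step : cnf V -> cnf V -> Prop :=
| in_clause S F c d :
    perm_eq S (c :: F) -> clause_step c d -> cnf_step S (d :: F)
| and_top S F : F != [::] -> perm_eq S ([:: Top] :: F) -> cnf_step S F
| and_bot S F :
    F != [::] -> perm_eq S ([:: Bot] :: F) -> cnf_step S [:: [:: Bot]]
| and_idem S F c d :
    perm_eq S [:: c, d & F] -> perm_eq c d -> cnf_step S (c :: F).

Definition reduced_cnf S : Prop := wf_cnf S /\ forall F, ~ cnf_step S F.

Definition trivial_cnf S : bool :=
  (S == [:: [:: Top]]) || (S == [:: [:: Bot]]).

Definition reduced_2cnf S : Prop :=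
  reduced_cnf S /\ (all (fun c => size c == 2) S \/ trivial_cnf S).

Definition eval_literal (t : V -> bool) l : bool :=
  match l with
  | Pos x => t x | Neg x => ~~ t x | Top => true | Bot => false
  end.

Definition eval_cnf (t : V -> bool) S : bool := all (has (eval_literal t)) S.

Definition satisfiable S : Prop := exists t : V -> bool, eval_cnf t S.

(* For a clause a \/ b over variables, this is the edge {|a|, |b|}. *)
Definition clause_vars c : {set V} :=
  [set x | (Pos x \in c) || (Neg x \in c)].

(* The edges of the multigraph, with multiplicity. *)
Definition cnf_edges S : seq {set V} := map clause_vars S.

Definition cnf_vars S : {set V} := \bigcup_(c <- S) clause_vars c.

Definition simple_2cnf S : Prop :=
  [/\ reduced_2cnf S, ~~ trivial_cnf S & uniq (cnf_edges S)].

Section GraphOf.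
Variable S : cnf V.

(* The test [x != y] makes the definition total: the clauses of a nontrivial
   reduced 2-CNF involve two distinct variables. *)
Definition cnf_adj (x y : {x : V | x \in cnf_vars S}) : bool :=
  (x != y) && ([set val x; val y] \in cnf_edges S).

Fact cnf_adj_sym : symmetric cnf_adj.
Proof. by move=> x y; rewrite /cnf_adj eq_sym setUC. Qed.

Fact cnf_adj_irr : irreflexive cnf_adj.
Proof. by move=> x; rewrite /cnf_adj eqxx. Qed.

Definition cnf_graph : sgraph := SGraph cnf_adj_sym cnf_adj_irr.

End GraphOf.
End CNF.

(** * Unsatisfiability graphs *)

(* The family of the graphs of unsatisfiable simple 2-CNFs, closed under
   isomorphism. *)
Definition unsat_graph (G : sgraph) : Prop :=
  exists (V : finType) (S : cnf V),
    [/\ simple_2cnf S, ~ satisfiable S & graph_iso G (cnf_graph S)].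

Definition minimal_unsat_graph (G : sgraph) : Prop :=
  unsat_graph G /\
  forall H : sgraph, proper_topological_minor H G -> ~ unsat_graph H.

Definition complete_set (M : sgraph -> Prop) : Prop :=
  (forall G, M G -> minimal_unsat_graph G) /\
  (forall G, unsat_graph G -> exists2 H, M H & topological_minor H G).

(** * The four graphs *)

Section EdgeList.
Variables (n : nat) (E : seq (nat * nat)).

Definition edge_adj (i j : 'I_n) : bool :=
  (i != j) && (((val i, val j) \in E) || ((val j, val i) \in E)).

Fact edge_adj_sym : symmetric edge_adj.
Proof. by move=> i j; rewrite /edge_adj eq_sym orbC. Qed.

Fact edge_adj_irr : irreflexive edge_adj.
Proof. by move=> i; rewrite /edge_adj eqxx. Qed.

Definition graph_of_edges : sgraph := SGraph edge_adj_sym edge_adj_irr.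

End EdgeList.

Definition butterfly : sgraph :=
  graph_of_edges 5 [:: (0, 1); (0, 2); (1, 2); (0, 3); (0, 4); (3, 4)].

Definition bowtie : sgraph :=
  graph_of_edges 6
    [:: (0, 1); (0, 2); (1, 2); (3, 4); (3, 5); (4, 5); (0, 3)].

Definition K4 : sgraph :=
  graph_of_edges 4 [:: (0, 1); (0, 2); (0, 3); (1, 2); (1, 3); (2, 3)].

Definition K113 : sgraph :=
  graph_of_edges 5
    [:: (0, 1); (0, 2); (1, 2); (0, 3); (1, 3); (0, 4); (1, 4)].

Definition four_graphs (G : sgraph) : Prop :=
  [\/ G = butterfly, G = bowtie, G = K4 | G = K113].

(* Main.v *)
Require Import Defs.
From mathcomp Require Import all_boot zify.

Set Implicit Arguments.
Unset Strict Implicit.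
Unset Printing Implicit Defensive.

(* Call a graph refutable if its edges can carry clauses, given by a sign at
   each end, that no assignment satisfies.  A graph is an unsatisfiability graph
   exactly when it is refutable and has no isolated vertex, and refutability is
   inherited along topological minors.

   Conversely, a refutable graph contains one of the four graphs, by induction
   on the number of vertices.  A vertex of degree 1 can be deleted, and a vertex
   of degree 2 with non-adjacent neighbours can be suppressed by resolution.
   Otherwise take a longest path v_0 ... v_k.  All neighbours of its ends are on
   it, and each end either has two chords, or has degree 2 and forms a triangle
   with its two neighbours.  According to the positions of these chords, the
   path and the chords contain a subdivision of one of the four graphs, or else
   there is a component which is a triangle or K_4 minus an edge; such a
   component is satisfiable and can be deleted.

   For minimality, the four graphs lose refutability when an edge is removed
   (by computation), so that a refutable proper topological minor would be
   suppressed at least once; but the neighbours of a vertex of degree 2 are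
   always adjacent in the four graphs. *)

(** * Refutable graphs *)

(* [s x y] is the sign of the variable [x] in the clause carried by the edge
   [xy]. *)
Definition falsified (G : sgraph) (s : G -> G -> bool) (t : G -> bool)
  (x y : G) : bool := [&& adj x y, t x != s x y & t y != s y x].

Definition refutable (G : sgraph) : Prop :=
  exists s : G -> G -> bool, forall t, exists x, exists y, falsified s t x y.

(** Pulled back along the embedding, an assignment of [H] falsifies a clause of [G], hence its
    image. [g] is the partial inverse of [f]; signs off the image are arbitrary. *)
Lemma refutable_sub (G H : sgraph) :
  iso_to_subgraph G H -> refutable G -> refutable H.
Proof.
move=> [f f_inj f_adj] [s sP].
pose g (x : H) : option G := [pick z | f z == x].
have fK z : g (f z) = Some z.
  by rewrite /g; case: pickP => [z' /eqP/f_inj -> //|/(_ z)]; rewrite eqxx.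
exists (fun x y => if g x is Some a then if g y is Some b then s a b else true
                   else true) => t.
have [x [y /and3P[xy tx ty]]] := sP (t \o f).
by exists (f x), (f y); rewrite /falsified !fK f_adj ?tx ?ty.
Qed.

(** The clause on [uv] is the resolvent of the two new clauses: [None] is positive in the one with
    [u] and negative in the one with [v]. *)
Lemma refutable_subdivide (G : sgraph) (u v : G) :
  adj u v -> refutable G -> refutable (subdivide_edge u v).
Proof.
move=> uv [s sP].
have neq_uv : u != v by apply: contraTneq uv => ->; rewrite adj_irr.
exists (fun (a b : option G) => match a, b with
  | Some x, Some y => s x y
  | Some x, None => if x == u then s u v else s v u
  | None, Some x => x == u
  | None, None => true end) => t.
have [x [y /and3P[xy tx ty]]] := sP (t \o some).
have [e|ne] := eqVneq [set x; y] [set u; v]; last first.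
  by exists (Some x), (Some y); rewrite /falsified /= xy ne tx ty.
have {x y xy tx ty e} [tu tv] : t (Some u) != s u v /\ t (Some v) != s v u.
  have xE : x \in [set u; v] by rewrite -e set21.
  have yE : y \in [set u; v] by rewrite -e set22.
  have neq_xy : x != y by apply: contraTneq xy => ->; rewrite adj_irr.
  move: xE yE neq_xy tx ty.
  by rewrite !inE => /orP[]/eqP-> /orP[]/eqP->; rewrite ?eqxx.
case tN : (t None).
- exists (Some v), None; rewrite /falsified /= set22 tN.
  by rewrite [v == u]eq_sym (negbTE neq_uv) tv.
- by exists (Some u), None; rewrite /falsified /= set21 tN eqxx tu.
Qed.

Lemma refutable_topological_minor (G H : sgraph) :
  topological_minor G H -> refutable G -> refutable H.
Proof.
move=> [G' + sub] rG; move: sub => /refutable_sub/[swap] sub; apply.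
by elim: sub => // K u v _ IH uv; apply: refutable_subdivide.
Qed.

(** * Signings and simple 2-CNFs *)

Section Literals.
Variable V : finType.
Implicit Types (l : literal V) (c : clause V) (S : cnf V).

Definition signed_literal (b : bool) (x : V) : literal V :=
  if b then Pos x else Neg x.

Lemma eval_signed_literal t b x :
  eval_literal t (signed_literal b x) = (t x == b).
Proof. by case: b; rewrite /= ?eqb_id ?eqbF_neg. Qed.

Lemma pos_signed_literal z b x : (Pos z == signed_literal b x) = b && (z == x).
Proof. by case: b => //; apply/eqP/eqP => [[]|->]. Qed.

Lemma neg_signed_literal z b x : (Neg z == signed_literal b x) = ~~ b && (z == x).
Proof. by case: b => //; apply/eqP/eqP => [[]|->]. Qed.

Lemma signed_literal_inj b b' x y :
  signed_literal b x = signed_literal b' y -> x = y /\ b = b'.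
Proof. by case: b; case: b' => // -[]. Qed.

Lemma clause_vars2 b b' x y :
  clause_vars [:: signed_literal b x; signed_literal b' y] = [set x; y].
Proof.
apply/setP=> z; rewrite !inE.
by rewrite !pos_signed_literal !neg_signed_literal; case: b; case: b'; rewrite ?orbF //= orbC.
Qed.

Lemma clause_vars_perm c c' : perm_eq c c' -> clause_vars c = clause_vars c'.
Proof. by move=> /perm_mem e; apply/setP=> z; rewrite !inE !e. Qed.

(** Any other clause of length 2 admits one of the four clause rules, and [in_clause] turns this
    into a step of [S]. *)
Lemma reduced_clause S c : reduced_cnf S -> c \in S -> size c = 2 ->
  exists b, exists b', exists x, exists y,
    x != y /\ c = [:: signed_literal b x; signed_literal b' y].
Proof.
move=> [_ red] cS c2.
have irr d : ~ clause_step c d.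
  by move=> st; apply: (red (d :: rem c S)); apply: in_clause st; apply: perm_to_rem.
case: c c2 {cS} irr => [//|l [//|l' [|//]]] _ irr.
have swap : perm_eq [:: l; l'] [:: l'; l].
  by rewrite (perm_catC [:: l] [:: l']).
have nT : l <> Top /\ l' <> Top.
  by split=> e; apply: (irr [:: Top]);
     [apply: (or_top (d := [:: l'])) | apply: (or_top (d := [:: l]))];
     rewrite -?e.
have nB : l <> Bot /\ l' <> Bot.
  by split=> e; [apply: (irr [:: l']); apply: or_bot
                | apply: (irr [:: l]); apply: or_bot]; rewrite -?e.
have n1 : l <> l'.
  by move=> e; apply: (irr [:: l]); apply: or_idem; rewrite -e.
have n2 : l' <> lneg l.
  by move=> e; apply: (irr [:: Top]); apply: (or_compl (l := l)); rewrite -e.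
have litE m : m <> Top -> m <> Bot -> exists b x, m = signed_literal b x.
  by case: m => // x; [exists true, x | exists false, x].
have [b [x lE]] := litE _ nT.1 nB.1; have [b' [y lE']] := litE _ nT.2 nB.2.
exists b, b', x, y; split; last by rewrite -lE -lE'.
apply/eqP => xy; move: n1 n2; rewrite lE lE' xy.
by case: b {lE}; case: b' {lE'}.
Qed.

Lemma uniq_map_inj_in (T U : eqType) (f : T -> U) (s : seq T) :
  uniq (map f s) -> {in s &, injective f}.
Proof.
elim: s => //= a s IH /andP[fa us] x y; rewrite !inE.
move=> /predU1P[->|xs] /predU1P[->|ys] // e.
- by rewrite e map_f in fa.
- by rewrite -e map_f in fa.
- exact: IH.
Qed.

End Literals.

Lemma simple_2cnf_clause (V : finType) (S : cnf V) c : simple_2cnf S -> c \in S ->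
  exists b, exists b', exists x, exists y,
    x != y /\ c = [:: signed_literal b x; signed_literal b' y].
Proof.
move=> [[red sz] nontriv _] cS.
have {}sz : all (fun c => size c == 2) S by case: sz nontriv => // ->.
have c2 : size c = 2 by apply/eqP/(allP sz).
exact: reduced_clause red cS c2.
Qed.

Lemma cnf_varsP (V : finType) (S : cnf V) x :
  reflect (exists2 c, c \in S & x \in clause_vars c) (x \in cnf_vars S).
Proof.
rewrite /cnf_vars; apply: (iffP idP).
  elim: S => [|c S IH]; first by rewrite big_nil inE.
  rewrite big_cons inE => /orP[xc|/IH[d dS xd]]; first by exists c; rewrite ?mem_head.
  by exists d; rewrite // inE dS orbT.
by move=> [c cS xc]; rewrite (big_rem c) //= inE xc.
Qed.

Lemma cnf_graph_no_isolated (V : finType) (S : cnf V) :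
  simple_2cnf S -> no_isolated_vertex (cnf_graph S).
Proof.
move=> simp [x xS]; have /cnf_varsP[c cS] := xS.
have [b [b' [y [z [yz cE]]]]] := simple_2cnf_clause simp cS.
have yS : y \in cnf_vars S.
  by apply/cnf_varsP; exists c => //; rewrite cE clause_vars2 set21.
have zS : z \in cnf_vars S.
  by apply/cnf_varsP; exists c => //; rewrite cE clause_vars2 set22.
have yzE : [set y; z] \in cnf_edges S.
  by apply/mapP; exists c => //; rewrite cE clause_vars2.
rewrite cE clause_vars2 !inE => xyz.
have : (x == y) || (x == z) by [].
move=> /orP[]/eqP xE.
- exists (exist _ z zS); rewrite /= /cnf_adj -val_eqE /= xE yz //.
- by exists (exist _ y yS); rewrite /= /cnf_adj -val_eqE /= xE eq_sym yz setUC.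
Qed.

(** The sign of [x] in the edge [xy] is read off the clause carried by that edge, which is unique
    because the 2-CNF is simple. *)
Lemma cnf_graph_refutable (V : finType) (S : cnf V) :
  simple_2cnf S -> ~ satisfiable S -> refutable (cnf_graph S).
Proof.
move=> simp unsat; have [_ _ /uniq_map_inj_in edge_inj] := simp.
exists (fun x y => has (fun c => (clause_vars c == [set val x; val y]) &&
                                 (Pos (val x) \in c)) S) => t.
pose T x := if insub x is Some z then t z else true.
have : ~~ eval_cnf T S by apply/negP => ev; apply: unsat; exists T.
case/allPn=> c cS.
have [b [b' [x [y [xy cE]]]]] := simple_2cnf_clause simp cS.
have cV : clause_vars c = [set x; y] by rewrite cE clause_vars2.
have xS : x \in cnf_vars S by apply/cnf_varsP; exists c; rewrite // cV set21.
have yS : y \in cnf_vars S by apply/cnf_varsP; exists c; rewrite // cV set22.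
rewrite {1}cE /= !eval_signed_literal orbF negb_or => /andP[Tx Ty].
exists (exist _ x xS), (exist _ y yS); rewrite /falsified /=.
have signE z : has (fun c => (clause_vars c == [set x; y]) && (Pos z \in c)) S
    = (Pos z \in c).
  apply/hasP/idP => [[d dS /andP[/eqP dV]]|zc]; last by exists c; rewrite ?cV ?eqxx.
  by rewrite (edge_inj d c) // dV cV.
have TE z (zS : z \in cnf_vars S) : T z = t (exist _ z zS).
  by rewrite /T insubT.
rewrite [[set y; x]]setUC !signE -!TE /cnf_adj -val_eqE /= xy.
have -> : [set x; y] \in cnf_edges S by apply/mapP; exists c.
rewrite cE !inE; move: Tx Ty xy; clear.
rewrite !pos_signed_literal !eqxx [y == x]eq_sym => Tx Ty /negbTE->.
by rewrite !andbF !andbT orbF orFb Tx.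
Qed.

Section CnfOfSigning.
Variables (G : sgraph) (s : G -> G -> bool).

Definition signed_clause (e : G * G) : clause G :=
  [:: signed_literal (s e.1 e.2) e.1; signed_literal (s e.2 e.1) e.2].

(** One orientation of each edge is kept, so that each edge yields a single clause. *)
Definition ordered_edge (e : G * G) : bool :=
  adj e.1 e.2 && (enum_rank e.1 < enum_rank e.2).

Definition signing_cnf : cnf G := [seq signed_clause e | e <- enum ordered_edge].

Lemma signed_clause_vars e : clause_vars (signed_clause e) = [set e.1; e.2].
Proof. exact: clause_vars2. Qed.

Lemma signing_cnfP c :
  reflect (exists2 e, ordered_edge e & c = signed_clause e) (c \in signing_cnf).
Proof.
by apply: (iffP mapP) => -[e eP ->]; exists e; rewrite // ?mem_enum in eP *.
Qed.

Lemma mem_signing_edges x y :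
  ([set x; y] \in cnf_edges signing_cnf) = adj x y.
Proof.
apply/mapP/idP => [[c /signing_cnfP[[a b] /andP[/= ab _] ->]]|xy].
  rewrite signed_clause_vars /= => e.
  have aE : a \in [set x; y] by rewrite e set21.
  have bE : b \in [set x; y] by rewrite e set22.
  move: aE bE ab; rewrite !inE.
  by move=> /orP[]/eqP-> /orP[]/eqP->; rewrite ?adj_irr // adj_sym.
have neq : enum_rank x != enum_rank y.
  by rewrite (inj_eq enum_rank_inj); apply: contraTneq xy => ->; rewrite adj_irr.
have [lt|lt|/val_inj e] := ltngtP (enum_rank x) (enum_rank y); last by rewrite e eqxx in neq.
- exists (signed_clause (x, y)); last by rewrite signed_clause_vars.
  by apply/signing_cnfP; exists (x, y); rewrite // /ordered_edge xy.
- exists (signed_clause (y, x)); last by rewrite signed_clause_vars setUC.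
  by apply/signing_cnfP; exists (y, x); rewrite // /ordered_edge adj_sym xy.
Qed.

Lemma uniq_signing_edges : uniq (cnf_edges signing_cnf).
Proof.
rewrite /cnf_edges -map_comp map_inj_in_uniq ?enum_uniq // => -[a b] [c d].
rewrite !mem_enum => /andP[/= _ ab] /andP[/= _ cd].
rewrite /= !signed_clause_vars /= => e.
have := set21 a b; rewrite e; have := set22 a b; rewrite e.
rewrite !inE => bE aE; move: bE aE ab.
move=> /orP[]/eqP-> /orP[]/eqP-> //; rewrite ?ltnn //.
by move=> dc; have := ltn_trans cd dc; rewrite ltnn.
Qed.

Lemma signed_clause_irreducible e d : e.1 != e.2 -> ~ clause_step (signed_clause e) d.
Proof.
case: e => x y /= xy; move cE: (signed_clause _) => c st.
case: st cE => {c d}.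
- move=> c d _ /perm_mem/(_ Top); rewrite mem_head => T cE; move: T.
  by rewrite -cE !inE /=; case: (s x y); case: (s y x).
- move=> c d _ /perm_mem/(_ Bot); rewrite mem_head => T cE; move: T.
  by rewrite -cE !inE /=; case: (s x y); case: (s y x).
- move=> c d l p cE; move: (perm_size p) (p); rewrite -cE => -[].
  case: d p => // _ _ /perm_mem lE.
  have l1 : signed_literal (s x y) x = l.
    by have := lE (signed_literal (s x y) x); rewrite !inE eqxx /= orbb => /esym/eqP.
  have l2 : signed_literal (s y x) y = l.
    by have := lE (signed_literal (s y x) y); rewrite !inE eqxx orbT /= orbb => /esym/eqP.
  by move: xy; rewrite -l2 in l1; have [-> _] := signed_literal_inj l1; rewrite eqxx.
- move=> c d l /perm_mem lE cE.
  have := lE l; have := lE (lneg l); rewrite -cE !inE !eqxx orbT /=.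
  have ne : (x == y) = false by apply: negbTE.
  have ne' : (y == x) = false by rewrite eq_sym.
  move=> /orP[]/eqP e1 /orP[]/eqP e2; move: e1; rewrite e2;
    case: (s x y); case: (s y x) => //= -[] e; by rewrite ?e ?eqxx in xy.
Qed.

Lemma signing_cnf_simple : refutable G -> simple_2cnf signing_cnf.
Proof.
move=> [s' s'P].
have size2 c : c \in signing_cnf -> size c = 2 by move=> /signing_cnfP[e _ ->].
have nonempty : signing_cnf != [::].
  have [x [y /andP[xy _]]] := s'P (fun=> true).
  have := mem_signing_edges x y; rewrite xy /cnf_edges.
  by case: (signing_cnf).
split; last exact: uniq_signing_edges.
- split; last by left; apply/allP => c /size2 ->.
  split.
    by rewrite /wf_cnf nonempty; apply/allP => c /size2; case: c.
  move=> F st; move SE: signing_cnf st => S st; case: st SE.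
  + move=> {}S {}F c d p st SE.
    have : c \in signing_cnf by rewrite SE (perm_mem p) mem_head.
    move=> /signing_cnfP[e /andP[eadj _] cE]; rewrite cE in st.
    apply: signed_clause_irreducible st.
    by apply: contraTneq eadj => ->; rewrite adj_irr.
  + move=> {}S {}F _ p SE.
    by have := size2 [:: Top]; rewrite SE (perm_mem p) mem_head => /(_ isT).
  + move=> {}S {}F _ p SE.
    by have := size2 [:: Bot]; rewrite SE (perm_mem p) mem_head => /(_ isT).
  + move=> {}S {}F c d p /clause_vars_perm cd SE.
    have := uniq_signing_edges; rewrite SE.
    by rewrite (perm_uniq (perm_map _ p)) /= cd inE eqxx.
- by apply/negP => /orP[]/eqP SE; [have := size2 [:: Top] | have := size2 [:: Bot]];
    rewrite SE mem_head => /(_ isT).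
Qed.

End CnfOfSigning.

(** From a CNF to a signing and back. The vertices of [G] are the variables of [signing_cnf]; as
    none is isolated, all of them occur. *)
Lemma unsat_graphP (G : sgraph) :
  unsat_graph G <-> no_isolated_vertex G /\ refutable G.
Proof.
split.
  move=> [V [S [simp unsat [f [g fK gK] f_adj]]]]; split.
    move=> x; have [y] := cnf_graph_no_isolated simp (f x).
    by rewrite -{1}(gK y) f_adj; exists (g y).
  apply: refutable_sub (cnf_graph_refutable simp unsat).
  exists g; first exact: can_inj gK.
  by move=> x y; rewrite -{1}(gK x) -{1}(gK y) f_adj.
move=> [noiso ref]; have [s sP] := ref.
exists G, (signing_cnf s); split; first exact: signing_cnf_simple.
  move=> [t /allP tS]; have [x [y /and3P[xy tx ty]]] := sP t.
  have := mem_signing_edges s x y; rewrite xy => /mapP[c cS].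
  have := tS _ cS; move: cS => /signing_cnfP[[a b] _ ->].
  rewrite signed_clause_vars /= !eval_signed_literal orbF => ab /setP e.
  have xE : x \in [set a; b] by rewrite -e set21.
  have yE : y \in [set a; b] by rewrite -e set22.
  move: xE yE xy tx ty ab; rewrite !inE.
  move=> /orP[]/eqP-> /orP[]/eqP->; rewrite ?adj_irr // => _;
    by move=> /negbTE-> /negbTE->.
have inS x : x \in cnf_vars (signing_cnf s).
  have [y] := noiso x; rewrite -(mem_signing_edges s) => /mapP[c cS cE].
  by apply/cnf_varsP; exists c; rewrite // -cE set21.
exists (fun x => exist _ x (inS x)).
  by exists val => [//|[x xS]]; apply: val_inj.
move=> x y; rewrite /= /cnf_adj -val_eqE /= mem_signing_edges.
by case: eqVneq => //= ->; rewrite adj_irr.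
Qed.

(** * Topological minors given by paths *)

Lemma subdivision_trans (G H K : sgraph) :
  subdivision G H -> subdivision H K -> subdivision G K.
Proof.
move=> GH; elim=> // {}K u v _ IH uv; exact: subdivision_step.
Qed.

(* [L] lists edges of [H] with the interiors of the paths of [G] replacing
   them; the other edges of [H] are mapped to edges of [G]. *)
Lemma topological_minor_paths (H G : sgraph) (f : H -> G)
    (L : seq (H * H * seq G)) :
  injective f ->
  (forall x y p, (x, y, p) \in L -> path (@adj G) (f x) (rcons p (f y))) ->
  uniq (flatten [seq l.2 | l <- L]) ->
  (forall x, f x \notin flatten [seq l.2 | l <- L]) ->
  (forall x y, adj x y -> adj (f x) (f y) \/
     exists p, (x, y, p) \in L \/ (y, x, p) \in L) ->
  topological_minor H G.
Proof.
have [n] := ubnP (size L + size (flatten [seq l.2 | l <- L])).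
elim: n H f L => [//|n IH] H f [|[[u v] p] L] ltn f_inj pathL uniqL fL f_adj.
  exists H; first exact: subdivision_refl.
  by exists f => // x y /f_adj[//|[p []]].
have pathL' x y q : (x, y, q) \in L -> path (@adj G) (f x) (rcons q (f y)).
  by move=> qL; apply: pathL; rewrite inE qL orbT.
move: ltn uniqL fL; rewrite /= size_cat cat_uniq => ltn /and3P[uniqp disj uniqL] fL.
have fL' x : f x \notin flatten [seq l.2 | l <- L].
  by have := fL x; rewrite mem_cat negb_or => /andP[].
(* An entry that needs no subdivision is dropped: [uv] is not an edge of [H], or its path has no
   interior. *)
have drop_edge : (adj u v -> adj (f u) (f v)) -> topological_minor H G.
  move=> uv; apply: (IH H f L) => //; first by lia.
  move=> x y xy; have := f_adj x y xy; case=> [|[q]]; first by left.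
  rewrite !inE !xpair_eqE => -[] /orP[/andP[/andP[/eqP xE /eqP yE] _]|qL].
  - by left; rewrite xE yE; apply: uv; rewrite -xE -yE.
  - by right; exists q; left.
  - by left; rewrite xE yE adj_sym; apply: uv; rewrite adj_sym -xE -yE.
  - by right; exists q; right.
have [uv|nuv] := boolP (adj u v); last by apply: drop_edge => /(negP nuv).
have pathuv := pathL u v p (mem_head _ _).
case: p => [|z p] in pathL ltn fL uniqp disj f_adj pathuv *.
  by apply: drop_edge; move: pathuv; rewrite /= andbT.
(* Otherwise [uv] is subdivided: the new vertex goes to the first interior vertex [z], and the rest
   of the path is listed for the edge from [None] to [Some v]. *)
pose f' (a : subdivide_edge u v) := oapp f z (a : option H).
pose lift_ (l : H * H * seq G) : option H * option H * seq G :=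
  (Some l.1.1, Some l.1.2, l.2).
have lift2 : [seq l.2 | l <- map lift_ L] = [seq l.2 | l <- L].
  by rewrite -map_comp; apply: eq_map.
have fz x : f x != z.
  by apply: contraNneq (fL x) => ->; rewrite mem_cat mem_head.
suff [K' subK iK] : topological_minor (subdivide_edge u v) G.
  exists K' => //; apply: subdivision_trans subK.
  by apply: subdivision_step uv; apply: subdivision_refl.
move: pathuv uniqp disj; rewrite /= => /andP[uz pathzv] /andP[zp uniqp].
rewrite -all_predC /= => /allP disj.
apply: (IH (subdivide_edge u v) f' ((None, Some v, p) :: map lift_ L)).
- by move: ltn; rewrite /= lift2 size_map size_cat; lia.
- move=> [x|] [y|] //= e; first by rewrite (f_inj _ _ e).
  + by have := fz x; rewrite e eqxx.
  + by have := fz y; rewrite -e eqxx.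
- move=> a b q; rewrite inE => /predU1P[[-> -> ->] //|/mapP[[[x y] q'] qL]].
  by move=> [-> -> ->]; apply: pathL'.
- rewrite /= lift2 cat_uniq uniqp uniqL andbT.
  apply/hasPn => x xL; have := disj _ xL.
  by rewrite /= inE negb_or => /andP[].
- move=> [x|] /=; rewrite lift2.
    by have := fL x; rewrite !mem_cat inE !negb_or => /andP[/andP[_ ->] ->].
  rewrite mem_cat negb_or zp; apply/negP => zL.
  by have := disj _ zL; rewrite /= mem_head.
have step x : x \in [set u; v] -> x = u \/ x = v.
  by rewrite !inE => /orP[]/eqP; [left | right].
move=> [x|] [y|] //=.
- move=> /andP[xy ne]; case: (f_adj x y xy) => [|[q qL]]; first by left.
  have {}qL : (x, y, q) \in L \/ (y, x, q) \in L.
    case: qL; rewrite inE !xpair_eqE => /orP[/andP[/andP[/eqP xE /eqP yE] _]|];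
      by [left | right | rewrite xE yE ?eqxx // setUC eqxx in ne].
  right; exists q; case: qL => qL; [left | right]; rewrite inE;
    apply/orP; right; apply/mapP; by [exists (x, y, q) | exists (y, x, q)].
- move=> /step[] ->; first by left.
  by right; exists p; right; rewrite mem_head.
- move=> /step[] ->; first by left; rewrite adj_sym.
  by right; exists p; left; rewrite mem_head.
Qed.

(* [xs] lists the branch vertices, and [ps] the interiors of the paths
   replacing the edges of [E], in the same order. *)
Lemma graph_of_edges_minor (n : nat) (E : seq (nat * nat)) (G : sgraph) (x0 : G)
    (xs : seq G) (ps : seq (seq G)) :
  size xs = n -> size ps = size E -> uniq (xs ++ flatten ps) ->
  all (fun e => (e.1 < n) && (e.2 < n)) E ->
  all (fun ep => path (@adj G) (nth x0 xs ep.1.1)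
                      (rcons ep.2 (nth x0 xs ep.1.2))) (zip E ps) ->
  topological_minor (graph_of_edges n E) G.
Proof.
case: n => [|n] sz_xs sz_ps; rewrite cat_uniq => /and3P[uniq_xs disj uniq_ps] En pathE.
  exists (graph_of_edges 0 E); first exact: subdivision_refl.
  by exists (fun=> x0) => -[].
pose L := [seq (inord ep.1.1, inord ep.1.2, ep.2) | ep <- zip E ps]
  : seq ('I_n.+1 * 'I_n.+1 * seq G).
have L2 : [seq l.2 | l <- L] = ps.
  rewrite /L -map_comp -[RHS](unzip2_zip (s := E)) ?sz_ps //; exact: eq_map.
apply: (@topological_minor_paths (graph_of_edges n.+1 E) G
         (fun i : 'I_n.+1 => nth x0 xs i) L).
- move=> i j /eqP; rewrite nth_uniq ?sz_xs ?ltn_ord //.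
  by move=> /eqP/val_inj.
- move=> i j p /mapP[[[a b] q] abq [-> -> ->]] /=.
  have := allP pathE _ abq; have : (a, b) \in E.
    by rewrite -(unzip1_zip (s := E) (t := ps)) ?sz_ps //; apply: (map_f fst abq).
  by move=> /(allP En) /andP[/= an bn]; rewrite !inordK.
- by rewrite L2.
- move=> i; rewrite L2; apply/negP => iL; case/negP: disj.
  by apply/hasP; exists (nth x0 xs i); rewrite // mem_nth // sz_xs.
have inL (i j : 'I_n.+1) : (val i, val j) \in E -> exists p, (i, j, p) \in L.
  move=> ijE; have ltE : index (val i, val j) E < size E by rewrite index_mem.
  exists (nth [::] ps (index (val i, val j) E)).
  apply/mapP; exists (nth ((0, 0), [::]) (zip E ps) (index (val i, val j) E)).
    by rewrite mem_nth // size_zip sz_ps minnn.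
  by rewrite nth_zip ?sz_ps //= nth_index //= !inord_val.
move=> i j /andP[_ /orP[]/inL[p pL]]; right; exists p; by [left | right].
Qed.

(** * The four graphs *)

(** This excludes proper subdivisions in the minimality proof. [ok] is a version on numbers, decided
    by computation: [a] and [b] are adjacent or [w] has a third neighbour. *)
Lemma four_graphs_degree2_adj :
  forall G, four_graphs G -> forall w a b : G,
  adj w a -> adj w b -> a != b ->
  (forall y, adj w y -> y = a \/ y = b) -> adj a b.
Proof.
pose ok (n : nat) (E : seq (nat * nat)) := all (fun w => all (fun a => all (fun b =>
  let e i j := (i != j) && (((i, j) \in E) || ((j, i) \in E)) in
  [&& e w a, e w b & a != b] ==>
  e a b || has (fun y => [&& e w y, y != a & y != b]) (iota 0 n))
    (iota 0 n)) (iota 0 n)) (iota 0 n).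
have okP n E : ok n E -> forall w a b : graph_of_edges n E,
    adj w a -> adj w b -> a != b ->
    (forall y, adj w y -> y = a \/ y = b) -> adj a b.
  move=> okE w a b wa wb ab wN.
  have mem (i : 'I_n) : val i \in iota 0 n by rewrite mem_iota ltn_ord.
  have /implyP := allP (allP (allP okE _ (mem w)) _ (mem a)) _ (mem b).
  have wab : [&& adj w a, adj w b & a != b] by rewrite wa wb ab.
  move=> /(_ wab)/orP[//|/hasP[y]].
  rewrite mem_iota /= => yn /and3P[wy ya yb].
  by case: (wN (Ordinal yn) wy) => e; move: ya yb; rewrite -e eqxx.
by move=> G [] ->; apply: okP.
Qed.

Lemma four_graphs_no_isolated G : four_graphs G -> no_isolated_vertex G.
Proof.
pose ok (n : nat) (E : seq (nat * nat)) := all (fun x => has (fun y =>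
  (x != y) && (((x, y) \in E) || ((y, x) \in E))) (iota 0 n)) (iota 0 n).
have okP n E : ok n E -> no_isolated_vertex (graph_of_edges n E).
  move=> okE x; have := allP okE (val x); rewrite mem_iota ltn_ord.
  move=> /(_ isT)/hasP[y]; rewrite mem_iota /= => yn xy.
  by exists (Ordinal yn).
by case=> ->; apply: okP.
Qed.

(** * Refutability and minimality of the four graphs *)

Fixpoint bitseqs (n : nat) : seq bitseq :=
  if n is n'.+1 then
    [seq true :: t | t <- bitseqs n'] ++ [seq false :: t | t <- bitseqs n']
  else [:: [::]].

Lemma mem_bitseqs n (t : bitseq) : size t = n -> t \in bitseqs n.
Proof.
elim: n t => [|n IH] [|b t] //= [/IH tn]; rewrite mem_cat.
by case: b; rewrite map_f ?orbT.
Qed.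

Lemma four_graphs_refutable G : four_graphs G -> refutable G.
Proof.
(* [P] holds the pairs [(x, y)] such that [x] is positive in the clause on [xy]. *)
pose ok (n : nat) (E P : seq (nat * nat)) :=
  all (fun e => [&& e.1 != e.2, e.1 < n & e.2 < n]) E &&
  all (fun t => has (fun e : nat * nat =>
     (nth true t e.1 != (e \in P)) &&
     (nth true t e.2 != ((e.2, e.1) \in P))) E) (bitseqs n).
have okP n E P : ok n E P -> refutable (graph_of_edges n E).
  move=> /andP[/allP En /allP ok_t].
  exists (fun i j : 'I_n => (val i, val j) \in P) => t.
  have /ok_t/hasP[[i j] ijE /andP[/= ti tj]] : codom t \in bitseqs n.
    by apply: mem_bitseqs; rewrite size_codom card_ord.
  have /and3P[/= ij lt_i lt_j] := En _ ijE.
  have tE k (lt_k : k < n) : nth true (codom t) k = t (Ordinal lt_k).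
    rewrite (nth_map (Ordinal lt_k)) ?size_enum_ord //; congr t.
    by apply: val_inj; rewrite /= nth_enum_ord.
  exists (Ordinal lt_i), (Ordinal lt_j); rewrite /falsified /= -!tE ti tj.
  by rewrite /edge_adj -val_eqE /= ij ijE.
case=> ->.
(* The first triangle forces 0 to be true, the second forces it to be false. *)
- by apply: (okP _ _ [:: (0, 1); (1, 0); (2, 1); (0, 2); (3, 0); (4, 3)]).
(* The triangles force 0 and 3 to be true, against the clause on [(0, 3)]. *)
- by apply: (okP _ _ [:: (0, 1); (1, 0); (2, 1); (0, 2);
                         (3, 4); (4, 3); (5, 4); (3, 5)]).
(* One of 1 and 2 holds, and each implies 3; but 3 implies 0, which excludes both. *)
- by apply: (okP _ _ [:: (0, 3); (1, 2); (2, 1); (3, 1); (3, 2)]).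
(* 1 implies 3, 3 implies 0, and 0 excludes 1, so 1 is false. Then 2 and 4 hold, 4 implies 0, and 0
   excludes 2. *)
- by apply: (okP _ _ [:: (1, 2); (2, 1); (0, 3); (3, 1); (0, 4); (1, 4); (4, 1)]).
Qed.

Definition clause_holds (e : nat * nat) (s : bool * bool) (t : bitseq) :=
  (nth true t e.1 == s.1) || (nth true t e.2 == s.2).

(* Whatever the signs of the edges of [E], one of the assignments of [T]
   satisfies all the clauses. *)
Fixpoint all_signings_sat (E : seq (nat * nat)) (T : seq bitseq) : bool :=
  if E is e :: E' then
    all (fun s => all_signings_sat E' (filter (clause_holds e s) T))
      [:: (true, true); (true, false); (false, true); (false, false)]
  else T != [::].

Lemma all_signings_satP E T (s : nat * nat -> bool * bool) :
  all_signings_sat E T ->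
  exists2 t, t \in T & forall e, e \in E -> clause_holds e (s e) t.
Proof.
elim: E T => [|e E IH] T.
  by case: T => // t T _; exists t; rewrite ?mem_head.
move=> /allP/(_ (s e)) okE.
have [|t] := IH (filter (clause_holds e (s e)) T).
  by apply: okE; case: (s e) => -[] [].
rewrite mem_filter => /andP[te tT] tE; exists t => // d.
by rewrite inE => /predU1P[->|/tE].
Qed.

(** Every edge is critical: for each edge, a computation runs through all signings of the other
    edges and always finds a satisfying assignment. *)
Lemma four_graphs_critical (G : sgraph) (s : G -> G -> bool) (x y : G) :
  four_graphs G -> adj x y ->
  exists t : G -> bool, forall a b, falsified s t a b -> [set a; b] = [set x; y].
Proof.
pose ok (n : nat) (E : seq (nat * nat)) :=
  all (fun e => [&& e.1 < n & e.2 < n]) E &&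
  all (fun e => all_signings_sat (filter (predC1 e) E) (bitseqs n)) E.
have okP n E (s' : graph_of_edges n E -> graph_of_edges n E -> bool)
    (x' y' : graph_of_edges n E) :
    ok n E -> adj x' y' -> exists t : graph_of_edges n E -> bool,
      forall a b, falsified s' t a b -> [set a; b] = [set x'; y'].
  move=> /andP[/allP En /allP okE] xy.
  pose s2 (e : nat * nat) := if insub e.1 is Some i then
    if insub e.2 is Some j then (s' i j, s' j i) else (true, true)
    else (true, true).
  have s2E (a b : 'I_n) : s2 (val a, val b) = (s' a b, s' b a).
    by rewrite /s2 /= !valK.
  have [e eE exy] : exists2 e, e \in E &
      e = (val x', val y') \/ e = (val y', val x').
    case/andP: xy => _ /orP[] eE; first by exists (val x', val y'); rewrite ?eE; auto.
    by exists (val y', val x'); rewrite ?eE; auto.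
  have [t _ tE] := all_signings_satP s2 (okE _ eE).
  exists (fun i => nth true t (val i)).
  have sat (a b : 'I_n) : (val a, val b) \in E ->
      falsified s' (fun i : 'I_n => nth true t (val i)) a b ->
      [set a; b] = [set x'; y'].
    move=> abE /and3P[_ ta tb].
    have [abe|ne] := eqVneq (val a, val b) e.
      case: exy abe => -> [/val_inj-> /val_inj->] //; exact: setUC.
    have := tE (val a, val b); rewrite mem_filter /= ne abE => /(_ isT).
    by rewrite /clause_holds s2E /= (negbTE ta) (negbTE tb).
  move=> a b ab; case/and3P: (ab) => /andP[_ /orP[]] abE ta tb; first exact: sat.
  rewrite setUC; apply: sat => //; rewrite /falsified tb ta adj_sym.
  by case/and3P: ab => ->.
move=> [] E; subst G; apply: okP; vm_compute; reflexivity.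
Qed.

(** An assignment that satisfies every clause off [xy], once pulled back to [K], still falsifies
    some clause of [K]; the image of its edge can only be [xy]. *)
Lemma four_graphs_edge_surj (G K : sgraph) (f : K -> G) :
  four_graphs G -> refutable K -> injective f ->
  (forall x y, adj x y -> adj (f x) (f y)) ->
  forall x y, adj x y -> exists x', exists y', [/\ x = f x', y = f y' & adj x' y'].
Proof.
move=> FG rK f_inj f_adj x y xy.
have [s' s'P] := rK.
pose g (z : G) : option K := [pick u | f u == z].
have fK z : g (f z) = Some z.
  by rewrite /g; case: pickP => [z' /eqP/f_inj -> //|/(_ z)]; rewrite eqxx.
pose s a b := if g a is Some a' then if g b is Some b' then s' a' b' else true
              else true.
have [t tP] := four_graphs_critical s FG xy.
have [a [b /and3P[ab ta tb]]] := s'P (t \o f).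
have := tP (f a) (f b); rewrite /falsified /s !fK f_adj // ta tb => /(_ isT) e.
have xE : x \in [set f a; f b] by rewrite e set21.
have yE : y \in [set f a; f b] by rewrite e set22.
have neq : x != y by apply: contraTneq xy => ->; rewrite adj_irr.
move: xE yE neq; rewrite !inE => /orP[]/eqP-> /orP[]/eqP->; rewrite ?eqxx // => _.
- by exists a, b.
- by exists b, a; rewrite adj_sym.
Qed.

Lemma four_graphs_minimal G : four_graphs G -> minimal_unsat_graph G.
Proof.
move=> FG; split.
  apply/unsat_graphP; split; first exact: four_graphs_no_isolated.
  exact: four_graphs_refutable.
move=> H [[K subK [f f_inj f_adj]] nisoHG] /unsat_graphP[_ rH].
have rK : refutable K.
  apply: refutable_topological_minor rH; exists K => //.
  by exists id.
have surj := four_graphs_edge_surj FG rK f_inj f_adj.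
case: subK f f_inj f_adj rK surj => [|{}K u v _ uv] f f_inj f_adj rK surj.
  (* Without subdivision [f] is an isomorphism: it is onto the edges, hence onto the vertices, as
     none is isolated. *)
  apply: nisoHG; exists f; last first.
    move=> x y; apply/idP/idP; last exact: f_adj.
    by move=> /surj[x' [y' [/f_inj-> /f_inj->]]].
  apply: inj_card_bij => //; rewrite -(card_codom f_inj).
  apply: subset_leq_card; apply/subsetP => x _.
  have [y /surj[x' [y' [-> _ _]]]] := four_graphs_no_isolated FG x.
  exact: codom_f.
have uv' : u != v by apply: contraTneq uv => ->; rewrite adj_irr.
(* The image of the last subdividing vertex has degree 2, so its neighbours are adjacent. Their edge
   comes from one between [Some u] and [Some v], which the subdivision removed. *)
have /surj[a [b [/f_inj/esym-> /f_inj/esym->]]] : adj (f (Some u)) (f (Some v)).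
  apply: (four_graphs_degree2_adj FG (w := f None)).
  - by apply: f_adj; rewrite /= set21.
  - by apply: f_adj; rewrite /= set22.
  - by apply: contra uv' => /eqP/f_inj[->].
  - move=> y /surj[w [y' [/f_inj<- ->]]]; case: y' => //= y'.
    by rewrite !inE => /orP[]/eqP->; auto.
by rewrite /= eqxx andbF.
Qed.

(** * Deleting vertices *)

Section Induced.
Variables (G : sgraph) (D : pred G).

Definition induced_adj (x y : {x | D x}) : bool := adj (val x) (val y).

Fact induced_adj_sym : symmetric induced_adj.
Proof. by move=> x y; apply: adj_sym. Qed.

Fact induced_adj_irr : irreflexive induced_adj.
Proof. by move=> x; apply: adj_irr. Qed.

Definition induced : sgraph := SGraph induced_adj_sym induced_adj_irr.

Lemma induced_topological_minor (H : sgraph) :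
  topological_minor H induced -> topological_minor H G.
Proof.
move=> [K subK [f f_inj f_adj]]; exists K => //.
by exists (val \o f) => // x y /val_inj/f_inj.
Qed.

Lemma card_induced x : ~~ D x -> #|induced| < #|G|.
Proof.
move=> Dx; rewrite card_sig; apply: proper_card; apply/properP.
by split; [apply/subsetP | exists x].
Qed.

(** If the values off [D] can be chosen to satisfy every clause meeting a deleted vertex, the
    falsified clause lies inside [D]. *)
Lemma induced_refutable (s : G -> G -> bool) :
  (forall t, exists x, exists y, falsified s t x y) ->
  (forall t, exists2 t', {in D, t' =1 t} &
     forall x y, ~~ D x -> ~~ falsified s t' x y) ->
  refutable induced.
Proof.
move=> sP ext; exists (fun x y => s (val x) (val y)) => t.
pose t0 x := if insub x is Some z then t z else true.
have [t' t'E t'P] := ext t0.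
have [x [y xy]] := sP t'.
have Dx : D x by apply: contraLR xy => /t'P.
have Dy : D y.
  have : falsified s t' y x by case/and3P: xy => xy tx ty; rewrite /falsified tx ty adj_sym xy.
  by apply: contraLR => /t'P.
exists (exist _ x Dx), (exist _ y Dy).
by move: xy; rewrite /falsified !t'E // /t0 !insubT.
Qed.

End Induced.

(** * Suppressing a vertex of degree 2 *)

Section Bypass.
Variables (G : sgraph) (w a b : G).

Definition bypass_adj (x y : {x : G | x != w}) : bool :=
  adj (val x) (val y) || (x != y) && ([set val x; val y] == [set a; b]).

Fact bypass_adj_sym : symmetric bypass_adj.
Proof. by move=> x y; rewrite /bypass_adj adj_sym eq_sym setUC. Qed.

Fact bypass_adj_irr : irreflexive bypass_adj.
Proof. by move=> x; rewrite /bypass_adj adj_irr eqxx. Qed.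

Definition bypass : sgraph := SGraph bypass_adj_sym bypass_adj_irr.

(** If an edge of [K] is sent to the pair [ab], it is subdivided once more and the new vertex sent
    to [w]; otherwise [K] already embeds in [G]. *)
Lemma bypass_topological_minor (H : sgraph) : adj w a -> adj w b ->
  topological_minor H bypass -> topological_minor H G.
Proof.
move=> wa wb [K subK [f f_inj f_adj]].
have f_inj' : injective (val \o f) by move=> x y /val_inj/f_inj.
have [/existsP[u /existsP[v /and3P[uv /eqP fu /eqP fv]]]|noedge] :=
  boolP [exists u, exists v, [&& adj u v, val (f u) == a & val (f v) == b]].
  exists (subdivide_edge u v); first exact: subdivision_step.
  exists (fun x : subdivide_edge u v => oapp (val \o f) w (x : option K)).
    move=> [x|] [y|] //= e; first by rewrite (f_inj' _ _ e).
      by case/eqP: (valP (f x)).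
    by case/eqP: (valP (f y)).
  move=> [x|] [y|] //=.
  - move=> /andP[xy ne]; have /orP[//|/andP[_ /eqP e]] := f_adj _ _ xy.
    case/eqP: ne.
    have inab z : (val (f z) \in [set a; b]) = (z \in [set u; v]).
      by rewrite !inE -fu -fv !val_eqE !(inj_eq f_inj).
    have xE := set21 (val (f x)) (val (f y)); rewrite e inab in xE.
    have yE := set22 (val (f x)) (val (f y)); rewrite e inab in yE.
    have nxy : x != y by apply: contraTneq xy => ->; rewrite adj_irr.
    move: xE yE nxy; rewrite !inE.
    by move=> /orP[]/eqP-> /orP[]/eqP->; rewrite ?eqxx // setUC.
  - by rewrite !inE => /orP[]/eqP->; rewrite /= ?fu ?fv adj_sym.
  - by rewrite !inE => /orP[]/eqP->; rewrite /= ?fu ?fv.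
exists K => //; exists (val \o f) => // x y xy.
have /orP[//|/andP[nxy /eqP e]] := f_adj _ _ xy.
have xE := set21 (val (f x)) (val (f y)).
have yE := set22 (val (f x)) (val (f y)).
move: xE yE; rewrite e !inE => /orP[]/eqP xE /orP[]/eqP yE.
- by move: nxy; rewrite -val_eqE /= xE yE eqxx.
- case/negP: noedge; apply/existsP; exists x; apply/existsP; exists y.
  by rewrite xy xE yE !eqxx.
- case/negP: noedge; apply/existsP; exists y; apply/existsP; exists x.
  by rewrite adj_sym xy xE yE !eqxx.
- by move: nxy; rewrite -val_eqE /= xE yE eqxx.
Qed.

Lemma card_bypass : #|bypass| < #|G|.
Proof.
rewrite card_sig; apply: proper_card; apply/properP.
by split; [apply/subsetP | exists w; rewrite // inE eqxx].
Qed.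

(* Resolving the two clauses containing [w] yields the clause on [ab]. *)
Lemma bypass_refutable : adj w a -> adj w b -> a != b -> ~~ adj a b ->
  (forall y, adj w y -> y = a \/ y = b) -> refutable G -> refutable bypass.
Proof.
move=> wa wb neq_ab nab wN [s sP].
have aw : a != w by apply: contraTneq wa => ->; rewrite adj_irr.
have bw : b != w by apply: contraTneq wb => ->; rewrite adj_irr.
(* In the clause on [ab], [a] and [b] keep their signs from the clauses on [aw] and [bw]. *)
pose s' (x y : G) := if (x == a) && (y == b) then s a w else
  if (x == b) && (y == a) then s b w else s x y.
exists (fun x y => s' (val x) (val y)) => t.
pose t0 x := if insub x is Some z then t z else true.
have t0E (x : G) (xw : x != w) : t0 x = t (exist _ x xw) by rewrite /t0 insubT.
(* If [a] satisfies the clause on [wa], [w] is used for the clause on [wb], and otherwise for the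
   one on [wa]. Both then hold unless the clause on [ab] is falsified. *)
pose t1 x := if x == w then
  (if t0 a == s a w then s w b else s w a) else t0 x.
have [ab|nab'] := boolP ((t0 a != s a w) && (t0 b != s b w)).
  exists (exist _ a aw), (exist _ b bw); rewrite /falsified /= -!t0E.
  rewrite /bypass_adj -val_eqE /= neq_ab eqxx orbT /s' !eqxx /=.
  by rewrite [b == a]eq_sym (negbTE neq_ab).
have sat y : ~~ falsified s t1 w y.
  apply/negP => /and3P[/wN yab]; rewrite /t1 eqxx.
  by case: yab nab' => ->; rewrite ?(negbTE aw) ?(negbTE bw);
     case: (t0 a == s a w); case: (t0 b == s b w); rewrite ?eqxx.
have [x [y xy]] := sP t1.
have xw : x != w by apply: contraTneq xy => ->; apply: sat.
have yw : y != w.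
  apply: contraTneq xy => ->; apply: contra (sat x).
  by move=> /and3P[xw' tx ty]; rewrite /falsified tx ty adj_sym xw'.
exists (exist _ x xw), (exist _ y yw); move: xy; rewrite /falsified /= /bypass_adj /=.
rewrite /t1 (negbTE xw) (negbTE yw) -!t0E => /and3P[xy tx ty]; rewrite xy /=.
(* [a] and [b] are not adjacent in [G], so [s'] agrees with [s] on the edges of [G]. *)
have off u v : adj u v -> (u == a) && (v == b) = false.
  by move=> uv; apply/negP => /andP[/eqP ua /eqP vb]; move: nab; rewrite -ua -vb uv.
have yx : adj y x by rewrite adj_sym.
have sE u v : adj u v -> s' u v = s u v.
  move=> uv; rewrite /s' off // andbC off //; by rewrite adj_sym.
by rewrite !sE // tx ty.
Qed.

End Bypass.

Lemma delete_leaf_refutable (G : sgraph) (w u : G) : adj w u ->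
  (forall y, adj w y -> y = u) -> refutable G -> refutable (induced (predC1 w)).
Proof.
move=> wu wN [s sP]; apply: (induced_refutable sP) => t.
exists (fun x => if x == w then s w u else t x).
  by move=> x; rewrite !inE => /negbTE->.
move=> x y; rewrite negbK => /eqP->.
by apply/negP => /and3P[/wN->]; rewrite eqxx eqxx.
Qed.

(* The clauses at [r1] and at [r2] can be satisfied for all but at most one
   choice of the values of [p] and [q] each. *)
Lemma delete_theta_refutable (G : sgraph) (p q r1 r2 : G) :
  p != q -> p != r1 -> p != r2 -> q != r1 -> q != r2 ->
  (forall y, adj p y -> y \in [:: q; r1; r2]) ->
  (forall y, adj q y -> y \in [:: p; r1; r2]) ->
  (forall y, adj r1 y -> y \in [:: p; q]) ->
  (forall y, adj r2 y -> y \in [:: p; q]) ->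
  refutable G -> refutable (induced [pred x | x \notin [:: p; q; r1; r2]]).
Proof.
move=> pq pr1 pr2 qr1 qr2 pN qN r1N r2N [s sP].
apply: (induced_refutable sP) => t.
(* [r] is used for the clause on [qr] if [p] satisfies the one on [pr], and for the latter
   otherwise; [bad] says that both clauses are left to [r], with opposite signs. *)
pose val_r r (vp vq : bool) := if vp == s p r then s r q else s r p.
pose bad r vp vq :=
  [&& vp != s p r, vq != s q r & s r p != s r q].
(* Of the four choices, the clause on [pq] excludes one, and [r1] and [r2] at most one each. *)
have [vp [vq [pqP r1P r2P]]] : exists vp, exists vq,
    [/\ (vp == s p q) || (vq == s q p), ~~ bad r1 vp vq & ~~ bad r2 vp vq].
  rewrite /bad; case: (s p q); case: (s q p); case: (s p r1); case: (s q r1);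
  case: (s p r2); case: (s q r2);
  first [by exists true, true; rewrite /= ?andbF | by exists true, false; rewrite /= ?andbF
       | by exists false, true; rewrite /= ?andbF | by exists false, false; rewrite /= ?andbF].
pose t' x := if x == p then vp else if x == q then vq else
  if x == r1 then val_r r1 vp vq else if x == r2 then val_r r2 vp vq else t x.
exists t'.
  move=> x; rewrite /t' !inE !negb_or => /and4P[].
  by move=> /negbTE-> /negbTE-> /negbTE-> /negbTE->.
have qp : q != p by rewrite eq_sym.
have t'p : t' p = vp by rewrite /t' /= eqxx.
have t'q : t' q = vq by rewrite /t' /= (negbTE qp) eqxx.
have t'r r : r \in [:: r1; r2] -> t' r = val_r r vp vq.
  rewrite /t' !inE /= => /orP[]/eqP->.
    by rewrite [r1 == p]eq_sym [r1 == q]eq_sym (negbTE pr1) (negbTE qr1) /= eqxx.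
  rewrite [r2 == p]eq_sym [r2 == q]eq_sym (negbTE pr2) (negbTE qr2) eqxx.
  (* [r2] may equal [r1]; the test for [r1] then returns the same value. *)
  by case: eqVneq => // ->.
have rP r : r \in [:: r1; r2] -> ~~ falsified s t' r p && ~~ falsified s t' r q.
  move=> rE; have : ~~ bad r vp vq by move: rE; rewrite !inE => /orP[]/eqP->.
  rewrite /falsified t'r // t'p t'q /bad /val_r; move: (vp) (vq) => b c.
  case: (adj r p); case: (adj r q); case: b; case: c; case: (s p r); case: (s q r);
    by case: (s r p); case: (s r q).
have symf x y : falsified s t' x y = falsified s t' y x.
  by rewrite /falsified adj_sym; congr andb; rewrite andbC.
have pqF : ~~ falsified s t' p q.
  by rewrite /falsified t'p t'q -negb_or negb_and negbK pqP orbT.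
have rN r y : r \in [:: r1; r2] -> adj r y -> y \in [:: p; q].
  by rewrite !inE => /orP[]/eqP-> => [/r1N|/r2N]; rewrite !inE.
have r1r : r1 \in [:: r1; r2] by rewrite mem_head.
have r2r : r2 \in [:: r1; r2] by rewrite !inE eqxx orbT.
move=> x y; rewrite inE negbK => xE; apply/negP => xyF.
have /andP[xy _] := xyF; move: xE xy xyF.
rewrite !inE => /or4P[]/eqP->.
- move=> /pN; rewrite !inE => /or3P[]/eqP->; first by rewrite (negbTE pqF).
  + by rewrite symf; case/andP: (rP _ r1r) => /negbTE->.
  + by rewrite symf; case/andP: (rP _ r2r) => /negbTE->.
- move=> /qN; rewrite !inE => /or3P[]/eqP->; first by rewrite symf (negbTE pqF).
  + by rewrite symf; case/andP: (rP _ r1r) => _ /negbTE->.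
  + by rewrite symf; case/andP: (rP _ r2r) => _ /negbTE->.
- move=> /r1N; rewrite !inE => /orP[]/eqP->.
  + by case/andP: (rP _ r1r) => /negbTE->.
  + by case/andP: (rP _ r1r) => _ /negbTE->.
- move=> /r2N; rewrite !inE => /orP[]/eqP->.
  + by case/andP: (rP _ r2r) => /negbTE->.
  + by case/andP: (rP _ r2r) => _ /negbTE->.
Qed.

(** * Longest paths *)

(* [lia] is slow when it has to process all the adjacency hypotheses. *)
Ltac nat_lia :=
  repeat match goal with H : is_true (adj _ _) |- _ => clear H end; lia.

Definition has_four_minor (G : sgraph) : Prop :=
  exists2 H, four_graphs H & topological_minor H G.

(** A path with [k] edges. A function on [nat] reduces positions to arithmetic; only its values up
    to [k] count. *)
Definition spath (G : sgraph) (k : nat) (v : nat -> G) : Prop :=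
  (forall i, i < k -> adj (v i) (v i.+1)) /\
  (forall i j, i <= k -> j <= k -> v i = v j -> i = j).

Definition longest (G : sgraph) (k : nat) : Prop :=
  forall v : nat -> G, ~ spath k.+1 v.

Section Spath.
Variable G : sgraph.
Implicit Types (v : nat -> G) (k : nat).

Lemma spath_nth k (x0 : G) (s : seq G) :
  size s = k.+1 -> sorted (@adj G) s -> uniq s -> spath k (nth x0 s).
Proof.
move=> sz_s s_sorted s_uniq; split=> [i lt_ik|i j le_ik le_jk /eqP].
  by move/(sortedP x0): s_sorted; apply; rewrite sz_s.
by rewrite nth_uniq ?sz_s // => /eqP.
Qed.

Lemma spath_rev k v : spath k v -> spath k (fun i => v (k - i)).
Proof.
move=> [vadj vinj]; split=> [i lt_ik|i j le_ik le_jk /vinj e].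
  by rewrite adj_sym -[k - i]subnSK //; apply: vadj; nat_lia.
by have := e ltac:(nat_lia) ltac:(nat_lia); nat_lia.
Qed.

(** Paths of length [k] correspond to finite functions, so their existence is decidable, and [k] is
    bounded by the number of vertices. *)
Lemma ex_longest (x y : G) : adj x y -> exists k, exists v, [/\ 0 < k, spath k v & longest G k].
Proof.
move=> xy.
pose P k := [exists f : {ffun 'I_k.+1 -> G}, injectiveb f &&
  [forall i : 'I_k.+1, forall j : 'I_k.+1, (j == i.+1 :> nat) ==> adj (f i) (f j)]].
have PP k : reflect (exists v, spath k v) (P k).
  apply: (iffP existsP) => [[f /andP[/injectiveP f_inj /forallP f_adj]]|[v [vadj vinj]]].
    exists (fun i => f (inord i)); split=> [i lt_ik|i j le_ik le_jk /f_inj e].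
      have /forallP/(_ (inord i.+1))/implyP := f_adj (inord i); apply.
      by rewrite !inordK //; nat_lia.
    by rewrite -(inordK (le_ik : i < k.+1)) e inordK.
  exists [ffun i : 'I_k.+1 => v i]; apply/andP; split.
    apply/injectiveP => i j; rewrite !ffunE => /vinj e.
    by apply/val_inj/e; rewrite -ltnS ltn_ord.
  apply/forallP => i; apply/forallP => j; apply/implyP => /eqP ij.
  by rewrite !ffunE ij; apply: vadj; rewrite -ij -ltnS ltn_ord.
have P1 : P 1.
  apply/PP; exists (nth x [:: x; y]); apply: spath_nth => //=; first by rewrite xy.
  by rewrite inE andbT; apply: contraTneq xy => ->; rewrite adj_irr.
have Pbound k : P k -> k <= #|G|.
  move=> /existsP[f /andP[/injectiveP /card_codom]]; rewrite card_ord => cE _.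
  by apply: leq_trans (max_card [in codom f]); rewrite cE.
case: (ex_maxnP (ex_intro _ 1 P1) Pbound) => k /PP[v vP] kmax.
exists k, v; split=> //; first exact: kmax.
by move=> v' v'P; have := kmax k.+1 ltac:(by apply/PP; exists v'); rewrite ltnn.
Qed.

(** A neighbour off the path could be prepended to it. *)
Lemma longest_start k v y : spath k v -> longest G k -> adj (v 0) y ->
  exists2 i, i <= k & y = v i.
Proof.
move=> [vadj vinj] kmax v0y.
have [/existsP[i /eqP yi]|/existsPn yN] := boolP [exists i : 'I_k.+1, y == v i].
  by exists i; rewrite // -ltnS.
have {}yN i : i <= k -> v i <> y.
  by move=> le_ik e; case/eqP: (yN (Ordinal (le_ik : i < k.+1))).
case: (kmax (fun i => if i is i'.+1 then v i' else y)); split.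
  by case=> [|i] /= lt_ik; [rewrite adj_sym | apply: vadj].
case=> [|i] [|j] //= le_ik le_jk e.
- by case: (yN j).
- by case: (yN i).
- by rewrite (vinj i j).
Qed.

Lemma longest_start_nbr k v y : spath k v -> longest G k -> adj (v 0) y -> y <> v 1 ->
  exists i, [/\ 2 <= i, i <= k & y = v i].
Proof.
move=> vP kmax v0y y1; have [[|[|i]] le_ik yE] := longest_start vP kmax v0y => //.
  by rewrite yE adj_irr in v0y.
by exists i.+2.
Qed.

Definition seg a b := iota a.+1 (b - a.+1).

Lemma spath_seg k v a b : spath k v -> a < b <= k ->
  path (@adj G) (v a) (rcons (map v (seg a b)) (v b)).
Proof.
move=> [vadj _] /andP[lt_ab le_bk]; rewrite /seg -map_rcons.
have -> : rcons (iota a.+1 (b - a.+1)) b = iota a.+1 (b - a).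
  by rewrite -[b - a]subnSK // -[(b - a.+1).+1]addn1 iotaD /= cats1; congr rcons; nat_lia.
have : a + (b - a) <= k by nat_lia.
move: (b - a) => m {b lt_ab le_bk}; elim: m a => //= m IH a le_k.
by rewrite vadj ?IH //; nat_lia.
Qed.

Lemma spath_rev_seg k v b : spath k v -> b <= k ->
  forall x, adj (v 0) x -> path (@adj G) (v b) (rcons (map v (rev (iota 0 b))) x).
Proof.
move=> [vadj _] le_bk x v0x; elim: b le_bk => [|b IH] le_bk; first by rewrite /= v0x.
rewrite -[b.+1]addn1 iotaD rev_cat /= add0n addn1 adj_sym vadj //=.
by apply: IH; nat_lia.
Qed.

Lemma spath_minor k v (n : nat) (E : seq (nat * nat)) (bs : seq nat)
    (ps : seq (seq nat)) :
  spath k v -> size bs = n -> size ps = size E ->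
  all (fun e => (e.1 < n) && (e.2 < n)) E ->
  all (fun i => i <= k) (bs ++ flatten ps) -> uniq (bs ++ flatten ps) ->
  all (fun ep => path (@adj G) (v (nth 0 bs ep.1.1))
         (rcons (map v ep.2) (v (nth 0 bs ep.1.2)))) (zip E ps) ->
  topological_minor (graph_of_edges n E) G.
Proof.
move=> [_ vinj] sz_bs sz_ps En /allP le_k uniq_i pathE.
apply: (@graph_of_edges_minor n E G (v 0) (map v bs) (map (map v) ps));
  rewrite ?size_map //.
  rewrite -map_flatten -map_cat map_inj_in_uniq // => i j /le_k le_ik /le_k le_jk.
  exact: vinj.
have nthE i : nth (v 0) (map v bs) i = v (nth 0 bs i).
  case: (ltnP i (size bs)) => [lt_i|le_i]; first exact: nth_map.
  by rewrite !nth_default ?size_map.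
have -> : zip E (map (map v) ps) = [seq (ep.1, map v ep.2) | ep <- zip E ps].
  by elim: (E) (ps) => [|e E' IH] [|p ps'] //=; rewrite IH.
rewrite all_map; apply: sub_all pathE => -[e p] /=.
by rewrite !nthE.
Qed.

End Spath.

Ltac index_bounds :=
  rewrite /seg /= ?cats0 /= ?all_cat /=; repeat (apply/andP; split);
  try (apply/allP => ?; rewrite ?(mem_rev, mem_iota)); nat_lia.

Ltac index_uniq :=
  rewrite /seg /= ?cats0 /= ?(cat_uniq, mem_cat, inE, mem_rev, mem_iota, in_nil);
  repeat (apply/andP; split); rewrite ?rev_uniq ?iota_uniq //;
  try (apply/hasPn => ?; rewrite ?(mem_cat, inE, mem_rev, mem_iota, in_nil)); nat_lia.

(** * Subdivisions formed by a path and chords at its ends *)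

Section Patterns.
Variables (G : sgraph) (k : nat) (v : nat -> G).
Hypothesis vP : spath k v.

Let vadj i : i < k -> adj (v i) (v i.+1).
Proof. by case: vP => vadj _; apply: vadj. Qed.

Let vadjS i j : j <= k -> j = i.+1 -> adj (v i) (v j) && adj (v j) (v i).
Proof. by move=> le_jk jE; rewrite jE in le_jk *; rewrite [adj (v i.+1) _]adj_sym vadj. Qed.

(** The chords close cycles on [0, ..., i] and on [a, ..., k]. These share one vertex (butterfly) or
    are joined by the stretch from [i] to [a] (bowtie). *)
Lemma minor_two_cycles i a : 2 <= i -> i <= a -> a + 2 <= k ->
  adj (v 0) (v i) -> adj (v k) (v a) -> has_four_minor G.
Proof.
move=> i2 le_ia ak v0i vka.
have vi0 : adj (v i) (v 0) by rewrite adj_sym.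
have vak : adj (v a) (v k) by rewrite adj_sym.
have /andP[_ vi1] := @vadjS i.-1 i ltac:(nat_lia) ltac:(nat_lia).
have va1 := @vadj a ltac:(nat_lia).
have [ia|lt_ia] : i = a \/ i < a by nat_lia.
  exists butterfly; first by constructor 1.
  apply: (spath_minor vP (bs := [:: i; 0; i.-1; i.+1; k])
     (ps := [:: [::]; [::]; seg 0 i.-1; [::]; [::]; seg i.+1 k])) => //.
  - index_bounds.
  - index_uniq.
  rewrite /= vi0 vi1 -?ia in va1 vak *; rewrite va1 vak !(spath_seg vP) //; nat_lia.
exists bowtie; first by constructor 2.
apply: (spath_minor vP (bs := [:: i; 0; i.-1; a; a.+1; k])
   (ps := [:: [::]; [::]; seg 0 i.-1; [::]; [::]; seg a.+1 k; seg i a])) => //.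
- index_bounds.
- index_uniq.
by rewrite /= vi0 vi1 va1 vak !(spath_seg vP) //; nat_lia.
Qed.

(** The branch vertices are at [b], [a], [j] and [k]. The link from [b] to [j] runs back to [v 0]
    and takes the chord there. *)
Lemma minor_K4 a b j : b < a -> a < j -> j < k ->
  adj (v 0) (v j) -> adj (v k) (v a) -> adj (v k) (v b) -> has_four_minor G.
Proof.
move=> ba aj jk v0j vka vkb.
have vak : adj (v a) (v k) by rewrite adj_sym.
have vbk : adj (v b) (v k) by rewrite adj_sym.
exists K4; first by constructor 3.
apply: (spath_minor vP (bs := [:: b; a; j; k])
  (ps := [:: seg b a; rev (iota 0 b); [::]; seg a j; [::]; seg j k])) => //.
- index_bounds.
- index_uniq.
by rewrite /= vak vbk !(spath_seg vP) ?(spath_rev_seg vP) //; nat_lia.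
Qed.
End Patterns.

(** * Structure of graphs without reducible vertices *)

(** Its failure yields a vertex of degree 1, or one of degree 2 with non-adjacent neighbours. In
    use, [w] is an end of a path and [u] the next vertex. *)
Definition fat (G : sgraph) : Prop := forall w u : G, adj w u ->
  (exists a, exists b, [/\ adj w a, adj w b, a != b, a != u & b != u]) \/
  (exists a, [/\ adj w a, a != u, adj u a & forall y, adj w y -> y = u \/ y = a]).

(* Taking [r1 = r2] covers the triangle. *)
Definition theta_component (G : sgraph) : Prop := exists p, exists q, exists r1, exists r2,
  [/\ [&& p != q, p != r1, p != r2, q != r1 & q != r2],
      forall y : G, adj p y -> y \in [:: q; r1; r2],
      forall y : G, adj q y -> y \in [:: p; r1; r2],
      forall y : G, adj r1 y -> y \in [:: p; q] &
      forall y : G, adj r2 y -> y \in [:: p; q]].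

Section Structure.
Variable G : sgraph.
Hypothesis G_fat : fat G.
Implicit Types (v : nat -> G) (k i j a b : nat).

Lemma longest_start_cases k v : spath k v -> longest G k -> 0 < k ->
  (exists i, exists j, [/\ 2 <= i, i < j, j <= k, adj (v 0) (v i) & adj (v 0) (v j)]) \/
  (exists i, [/\ 2 <= i, i <= k, adj (v 0) (v i), adj (v 1) (v i) &
     forall y, adj (v 0) y -> y = v 1 \/ y = v i]).
Proof.
move=> vP kmax k_gt0; have v01 : adj (v 0) (v 1) by apply vP.
have [[x [y [v0x v0y xy /eqP x1 /eqP y1]]]|[x [v0x /eqP x1 v1x v0N]]] := G_fat v01.
  have [i [i2 ik xE]] := longest_start_nbr vP kmax v0x x1.
  have [j [j2 jk yE]] := longest_start_nbr vP kmax v0y y1.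
  rewrite xE yE in xy v0x v0y; left.
  have [lt_ij|lt_ji|ij] := ltngtP i j; last by rewrite ij eqxx in xy.
  - by exists i, j.
  - by exists j, i.
have [i [i2 ik xE]] := longest_start_nbr vP kmax v0x x1.
by right; exists i; rewrite -xE.
Qed.

Lemma longest_end_cases k v : spath k v -> longest G k -> 0 < k ->
  (exists a, exists b, [/\ b < a, a + 2 <= k, adj (v k) (v a) & adj (v k) (v b)]) \/
  (exists a, [/\ a + 2 <= k, adj (v k) (v a), adj (v k.-1) (v a) &
     forall y, adj (v k) y -> y = v k.-1 \/ y = v a]).
Proof.
move=> vP kmax k_gt0.
have [[i [j]]|[i]] := longest_start_cases (spath_rev vP) kmax k_gt0; rewrite !subn0 ?subn1.
- by move=> [i2 ij jk vki vkj]; left; exists (k - i), (k - j); split=> //; nat_lia.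
- by move=> [i2 ik vki vki' vkN]; right; exists (k - i); split=> //; nat_lia.
Qed.

(** The path [p, r1, q, r2] has maximal length, so [p] has no neighbour off it; likewise for [q]. *)
Lemma theta_component4 (p q r1 r2 : G) : longest G 3 ->
  uniq [:: p; q; r1; r2] -> adj p q -> adj p r1 -> adj p r2 -> adj q r1 -> adj q r2 ->
  (forall y, adj r1 y -> y = p \/ y = q) -> (forall y, adj r2 y -> y = p \/ y = q) ->
  theta_component G.
Proof.
move=> max3 uniq4 pq pr1 pr2 qr1 qr2 r1N r2N.
have nbr x y z : uniq [:: x; y; r1; r2] -> adj x r1 -> adj y r1 -> adj y r2 -> adj x z ->
    z \in [:: y; r1; r2].
  move=> xy4 xr1 yr1 yr2 xz.
  have P : spath 3 (nth x [:: x; r1; y; r2]).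
    apply: spath_nth => //=; first by rewrite xr1 adj_sym yr1 yr2.
    move: xy4; rewrite /= !inE !negb_or => /and4P[/and3P[xy xr1' xr2] /andP[yr1' yr2'] r12 _].
    by rewrite xy xr1' xr2 r12 yr2' [r1 == y]eq_sym yr1'.
  have [i le_i zE] := longest_start P max3 xz.
  move: xz; rewrite zE; case: i le_i {zE} => [|[|[|[|//]]]] _ /=;
    by rewrite ?adj_irr // !inE eqxx ?orbT.
have uniq4' : uniq [:: q; p; r1; r2].
  by rewrite -(perm_uniq (s1 := [:: p; q; r1; r2])) // (perm_catCA [:: p] [:: q]).
exists p, q, r1, r2; split.
- by move: uniq4; rewrite /= !inE !negb_or => /and4P[/and3P[-> -> ->] /andP[-> ->] _ _].
- by move=> y; apply: nbr.
- by move=> y; apply: nbr.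
- by move=> y /r1N[]->; rewrite !inE eqxx ?orbT.
- by move=> y /r2N[]->; rewrite !inE eqxx ?orbT.
Qed.

(** From any corner, the triangle gives a path of maximal length, so no corner has a neighbour
    outside. *)
Lemma theta_component3 (x y z : G) : longest G 2 ->
  adj x y -> adj y z -> adj x z -> theta_component G.
Proof.
move=> max2.
have ne (u w : G) : adj u w -> u != w by move=> uw; apply: contraTneq uw => ->; rewrite adj_irr.
have nbr (a b c d : G) : adj a b -> adj b c -> adj a c -> adj a d -> d \in [:: b; c].
  move=> ab bc ac ad.
  have P : spath 2 (nth a [:: a; b; c]).
    apply: spath_nth => //=; first by rewrite ab bc.
    by rewrite !inE negb_or !ne.
  have [i le_i dE] := longest_start P max2 ad.
  move: ad; rewrite dE; case: i le_i {dE} => [|[|[|//]]] _ /=;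
    by rewrite ?adj_irr // !inE eqxx ?orbT.
move=> xy yz xz.
have yx : adj y x by rewrite adj_sym.
have zy : adj z y by rewrite adj_sym.
have zx : adj z x by rewrite adj_sym.
exists x, y, z, z; split.
- by rewrite !ne.
- by move=> d /(nbr _ _ _ _ xy yz xz); rewrite !inE orbb.
- by move=> d /(nbr _ _ _ _ yx xz yz); rewrite !inE orbb.
- by move=> d /(nbr _ _ _ _ zx xy zy).
- by move=> d /(nbr _ _ _ _ zx xy zy).
Qed.

Lemma structure_closed_start k v : spath k v -> longest G k -> 2 <= k ->
  adj (v 0) (v k) -> adj (v 1) (v k) ->
  (forall y, adj (v 0) y -> y = v 1 \/ y = v k) ->
  has_four_minor G \/ theta_component G.
Proof.
move=> vP kmax k2 v0k v1k v0N; have [vadj vinj] := vP.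
have [k2E|k3] : k = 2 \/ 2 < k by nat_lia.
  right; rewrite k2E in kmax v0k v1k.
  by apply: (theta_component3 kmax _ v1k v0k); apply: vadj; nat_lia.
(* The same vertices in the order [v 1], [v 0], [v k], [v k.-1], ..., [v 2]: a path whose first
   three vertices form a triangle. *)
pose sg i := if i == 0 then 1 else if i == 1 then 0 else k + 2 - i.
pose u i := v (sg i).
have sg2 i : 2 <= i -> sg i = k + 2 - i by case: i => [|[|i]].
have uP : spath k u.
  split=> [[|[|i]] lt_ik|i j le_ik le_jk /vinj]; rewrite /u.
  - by rewrite /sg /= adj_sym; apply: vadj; nat_lia.
  - by rewrite /sg /= addn2 subSS subn1.
  - rewrite !sg2 // adj_sym; have -> : k + 2 - i.+2 = (k + 2 - i.+3).+1 by nat_lia.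
    by apply: vadj; nat_lia.
  - by rewrite /sg; case: i j le_ik le_jk => [|[|i]] [|[|j]] /= ? ?; nat_lia.
have u02 : adj (u 0) (u 2) by rewrite /u (sg2 2) // addnK.
have ukE : u k = v 2 by rewrite /u sg2 //; congr v; nat_lia.
(* [u 1] is [v 0], whose only neighbours are [v 1] and [v k], so the end [v 2] is not adjacent to
   it. *)
have nv20 a : a < 2 -> adj (u k) (u a) -> a = 0.
  case: a => [|[|//]] // _; rewrite ukE /u /sg /= adj_sym => /v0N[]/vinj; nat_lia.
have [[a [b [ba ak vka vkb]]]|[a [ak vka vka' vkN]]] := longest_end_cases uP kmax ltac:(nat_lia).
  have [a2|a2] := leqP 2 a; first by left; apply: (minor_two_cycles uP _ a2 ak u02 vka).
  by have := nv20 a a2 vka; nat_lia.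
have [a2|a2] := leqP 2 a; first by left; apply: (minor_two_cycles uP _ a2 ak u02 vka).
have a0 := nv20 a a2 vka; rewrite {a a2 ak}a0 ukE in vka vka' vkN.
have uk1E : u k.-1 = v 3 by rewrite /u sg2; [congr v | ]; nat_lia.
rewrite uk1E /u /sg /= in vka vka' vkN.
have v10 : adj (v 1) (v 0) by rewrite adj_sym; apply: vadj; nat_lia.
have v12 : adj (v 1) (v 2) by apply: vadj; nat_lia.
have v13 : adj (v 1) (v 3) by rewrite adj_sym.
have v23 : adj (v 2) (v 3) by apply: vadj; nat_lia.
(* The triangles on [0, 1, k] and on [1, 2, 3] share an edge if [k = 3], and only [v 1]
   otherwise. *)
have [k3E|k4] : k = 3 \/ 3 < k by nat_lia.
  right; rewrite k3E in kmax v0k v1k v0N vinj.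
  apply: (@theta_component4 (v 1) (v 3) (v 0) (v 2)) => //.
  - rewrite -[[:: _; _; _; _]]/(map v [:: 1; 3; 0; 2]) map_inj_in_uniq //.
    move=> i j; rewrite !inE => iE jE; apply: vinj; nat_lia.
  - by rewrite adj_sym.
  - by rewrite adj_sym.
  - by move=> y /vkN[]; [right | left].
left; exists butterfly; first by constructor 1.
apply: (spath_minor vP (bs := [:: 1; 0; k; 2; 3]) (ps := nseq 6 [::])) => //.
- index_bounds.
- index_uniq.
by rewrite /= v10 v1k v0k v12 v13 v23.
Qed.

(** The cycles closed by the chords to [v i] and [v a] share at most a vertex, or else [a < i] and
    the chord to [v b] completes a subdivided [K4]. *)
Lemma minor_third_chord k v i a b : spath k v -> 2 <= i -> i < k -> b < a -> a + 2 <= k ->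
  adj (v 0) (v i) -> adj (v k) (v a) -> adj (v k) (v b) -> has_four_minor G.
Proof.
move=> vP i2 ik ba ak v0i vka vkb; have [le_ia|lt_ai] := leqP i a.
  exact: (minor_two_cycles vP i2 le_ia ak v0i vka).
exact: (minor_K4 vP ba lt_ai ik v0i vka vkb).
Qed.

Lemma structure_two_triangles k v i a : spath k v -> longest G k ->
  2 <= i -> i < k -> 0 < a -> a + 2 <= k ->
  adj (v 0) (v i) -> adj (v 1) (v i) -> (forall y, adj (v 0) y -> y = v 1 \/ y = v i) ->
  adj (v k) (v a) -> adj (v k.-1) (v a) ->
  (forall y, adj (v k) y -> y = v k.-1 \/ y = v a) ->
  has_four_minor G \/ theta_component G.
Proof.
move=> vP kmax i2 ik a0 ak v0i v1i v0N vka vka' vkN; have [vadj vinj] := vP.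
have [le_ia|lt_ai] := leqP i a.
  by left; apply: (minor_two_cycles vP i2 le_ia ak v0i vka).
have v01 : adj (v 0) (v 1) by apply: vadj; nat_lia.
have vk'k : adj (v k.-1) (v k) by rewrite -[in v k](ltn_predK ik); apply: vadj; nat_lia.
have v10 : adj (v 1) (v 0) by rewrite adj_sym.
have vi0 : adj (v i) (v 0) by rewrite adj_sym.
have vi1 : adj (v i) (v 1) by rewrite adj_sym.
have vkk' : adj (v k) (v k.-1) by rewrite adj_sym.
have vak : adj (v a) (v k) by rewrite adj_sym.
have vak' : adj (v a) (v k.-1) by rewrite adj_sym.
have [a1|a1] : a = 1 \/ 1 < a by nat_lia.
  subst a; have [iE|ik'] : i = k.-1 \/ i < k.-1 by nat_lia.
    (* The triangles share the edge from [v 1] to [v k.-1]. If [k > 3], the stretch of the path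
       between these two vertices is the third link of [K113]. *)
    subst i; have [k3|k4] : k = 3 \/ 3 < k by nat_lia.
      subst k; right.
      apply: (@theta_component4 (v 1) (v 2) (v 0) (v 3)) => //.
        rewrite -[[:: _; _; _; _]]/(map v [:: 1; 2; 0; 3]) map_inj_in_uniq //.
        by move=> i j; rewrite !inE => iE jE; apply: vinj; nat_lia.
      by move=> y /vkN[]; [right | left].
    left; exists K113; first by constructor 4.
    have vk'k'' : adj (v k.-1) (v k.-2).
      by have := vadj k.-2 ltac:(nat_lia); rewrite adj_sym prednK //; nat_lia.
    apply: (spath_minor vP (bs := [:: k.-1; 1; 0; k; k.-2])
      (ps := [:: [::]; [::]; [::]; [::]; [::]; [::]; seg 1 k.-2])) => //.
    - index_bounds.
    - index_uniq.
    by rewrite /= vi1 vi0 v10 vk'k vak vk'k'' (spath_seg vP) //; nat_lia.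
  (* The triangles share only [v 1]. *)
  left; exists butterfly; first by constructor 1.
  apply: (spath_minor vP (bs := [:: 1; 0; i; k; k.-1]) (ps := nseq 6 [::])) => //.
  - index_bounds.
  - index_uniq.
  by rewrite /= v10 v1i v0i vak vak' vkk'.
have [iE|ik'] : i = k.-1 \/ i < k.-1 by nat_lia.
  (* The triangles share only [v k.-1]. *)
  left; exists butterfly; first by constructor 1.
  subst i.
  apply: (spath_minor vP (bs := [:: k.-1; 0; 1; k; a]) (ps := nseq 6 [::])) => //.
  - index_bounds.
  - index_uniq.
  by rewrite /= vi0 vi1 v01 vk'k vka' vka.
(* The triangles are disjoint, and joined by the stretch from [v 1] to [v a]. *)
left; exists bowtie; first by constructor 2.
apply: (spath_minor vP (bs := [:: 1; 0; i; a; k; k.-1])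
  (ps := [:: [::]; [::]; [::]; [::]; [::]; [::]; seg 1 a])) => //.
- index_bounds.
- index_uniq.
by rewrite /= v10 v1i v0i vak vak' vkk' (spath_seg vP) //; nat_lia.
Qed.

Lemma fat_structure (x y : G) : adj x y -> has_four_minor G \/ theta_component G.
Proof.
move=> /ex_longest[k [v [k_gt0 vP kmax]]].
have rP := spath_rev vP.
have [[i [j [i2 ij jk v0i v0j]]]|[i [i2 ik v0i v1i v0N]]] :=
    longest_start_cases vP kmax k_gt0;
  have [[a [b [ba ak vka vkb]]]|[a [ak vka vka' vkN]]] :=
    longest_end_cases vP kmax k_gt0.
- left; apply: (minor_third_chord vP i2 _ ba ak v0i vka vkb); nat_lia.
(* If the chord at [v k] leads to [v 0], it closes the whole path into a cycle; otherwise the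
   reversed path has one chord at its start and two at its end. *)
- have [a0|a_gt0] := posnP a.
    subst a; apply: (structure_closed_start rP kmax); rewrite ?subn0 ?subnn ?subn1 //; nat_lia.
  left; apply: (@minor_third_chord k (fun i => v (k - i)) (k - a) (k - i) (k - j));
    rewrite ?subn0 ?subnn ?subKn //; nat_lia.
- have [ikE|lt_ik] : i = k \/ i < k by nat_lia.
    by subst i; apply: (structure_closed_start vP kmax).
  by left; apply: (minor_third_chord vP i2 lt_ik ba ak v0i vka vkb).
- have [ikE|lt_ik] : i = k \/ i < k by nat_lia.
    by subst i; apply: (structure_closed_start vP kmax).
  have [a0|a_gt0] := posnP a.
    subst a; apply: (structure_closed_start rP kmax); rewrite ?subn0 ?subnn ?subn1 //; nat_lia.
  exact: (structure_two_triangles vP kmax i2 lt_ik a_gt0 ak v0i v1i v0N vka vka' vkN).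
Qed.

End Structure.

(** A failure at [w] and [u] means that [w] has at most one neighbour besides [u], and that such a
    neighbour is not adjacent to [u]. *)
Lemma fat_dec (G : sgraph) : fat G \/ exists w, exists u : G, adj w u /\
  ((forall y, adj w y -> y = u) \/
   exists a, [/\ adj w a, a != u, ~~ adj u a & forall y, adj w y -> y = u \/ y = a]).
Proof.
pose ok (w u : G) := adj w u ==>
  ([exists a, exists b, [&& adj w a, adj w b, a != b, a != u & b != u]] ||
   [exists a, [&& adj w a, a != u, adj u a & [forall y, adj w y ==> ((y == u) || (y == a))]]]).
have [/forallP okG|] := boolP [forall w, forall u, ok w u].
  left=> w u wu; have /forallP/(_ u)/implyP/(_ wu)/orP[] := okG w.
    move=> /existsP[a /existsP[b /and5P[wa wb ab au bu]]].
    by left; exists a, b.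
  move=> /existsP[a /and4P[wa au ua /forallP wN]]; right; exists a; split=> // y wy.
  by have := wN y; rewrite wy => /orP[]/eqP; [left | right].
rewrite negb_forall => /existsP[w]; rewrite negb_forall => /existsP[u].
rewrite negb_imply negb_or => /and3P[wu no2 no1]; right; exists w, u; split=> //.
have [/existsP[a /andP[wa au]]|noa] := boolP [exists a, adj w a && (a != u)]; last first.
  left=> y wy; apply/eqP; apply: contraNT noa => yu.
  by apply/existsP; exists y; rewrite wy.
have wN y : adj w y -> y = u \/ y = a.
  move=> wy; have [->|yu] := eqVneq y u; first by left.
  right; apply/eqP; apply: contraNT no2 => ya.
  by apply/existsP; exists y; apply/existsP; exists a; rewrite wy wa ya yu au.
right; exists a; split=> //; apply: contra no1 => ua.
apply/existsP; exists a; rewrite wa au ua; apply/forallP => y; apply/implyP.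
by move=> /wN[]->; rewrite eqxx ?orbT.
Qed.

Lemma refutable_has_four_minor (G : sgraph) : refutable G -> has_four_minor G.
Proof.
have [n] := ubnP #|G|; elim: n G => // n IH G ltGn rG.
have smaller (D : pred G) x : ~~ D x -> refutable (induced D) -> has_four_minor G.
  move=> Dx rD; have [|H FH] := IH _ _ rD; first by have := card_induced Dx; nat_lia.
  by move/induced_topological_minor; exists H.
have [G_fat|[w [u [wu [wN|[a [wa au ua wN]]]]]]] := fat_dec G; last 2 first.
- by apply: (smaller (predC1 w) w); rewrite ?inE ?eqxx //; apply: delete_leaf_refutable wN rG.
- have rB : refutable (bypass w u a) by apply: bypass_refutable; rewrite // eq_sym.
  have [|H FH] := IH _ _ rB; first by have := card_bypass w u a; nat_lia.
  by move/(bypass_topological_minor wu wa); exists H.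
have [s sP] := rG; have [x [y /andP[xy _]]] := sP (fun=> true).
have [//|[p [q [r1 [r2 [/and5P[pq pr1 pr2 qr1 qr2] pN qN r1N r2N]]]]]] :=
  fat_structure G_fat xy.
apply: (smaller _ p _ (delete_theta_refutable pq pr1 pr2 qr1 qr2 pN qN r1N r2N rG)).
by rewrite /= mem_head.
Qed.

(** * Minimal unsatisfiability graphs *)

Lemma graph_iso_sym (G H : sgraph) : graph_iso G H -> graph_iso H G.
Proof.
move=> [f [g fK gK] f_adj]; exists g; first by exists f.
by move=> x y; rewrite -f_adj !gK.
Qed.

Lemma graph_iso_trans (G H K : sgraph) : graph_iso G H -> graph_iso H K -> graph_iso G K.
Proof.
move=> [f f_bij f_adj] [g g_bij g_adj]; exists (g \o f); first exact: bij_comp.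
by move=> x y; rewrite /= g_adj f_adj.
Qed.

Lemma graph_iso_sub (G H : sgraph) : graph_iso G H -> iso_to_subgraph G H.
Proof. by move=> [f f_bij f_adj]; exists f => [|x y]; [apply: bij_inj | rewrite f_adj]. Qed.

(** By finite search. This extracts an isomorphism from the negation in [proper_topological_minor]
    constructively. *)
Lemma graph_iso_dec (G H : sgraph) : graph_iso G H \/ ~ graph_iso G H.
Proof.
have [/existsP[f /and3P[/injectiveP f_inj /eqP GH /forallP f_adj]]|no] :=
  boolP [exists f : {ffun G -> H}, [&& injectiveb f, #|G| == #|H| &
    [forall x, forall y, adj (f x) (f y) == adj x y]]].
  left; exists f; first by apply: inj_card_bij; rewrite ?GH.
  by move=> x y; have /forallP/(_ y)/eqP := f_adj x.
right=> -[f f_bij f_adj]; case/negP: no; apply/existsP; exists (finfun f).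
apply/and3P; split; last by do 2![apply/forallP => ?]; rewrite !ffunE f_adj.
  by apply/injectiveP => x y; rewrite !ffunE; apply: bij_inj.
by rewrite (bij_eq_card f_bij).
Qed.

Lemma unsat_graph_has_four_minor (G : sgraph) : unsat_graph G -> has_four_minor G.
Proof. by move=> /unsat_graphP[_ /refutable_has_four_minor]. Qed.

(** The vertices of [cnf_graph] occur in clauses, so none is isolated, whereas adding isolated
    vertices to a graph preserves its topological minors; hence the condition in the third item. *)
Theorem theorem18 :
  [/\ complete_set four_graphs,
      (forall G : sgraph,
         minimal_unsat_graph G <-> exists2 H, four_graphs H & graph_iso G H),
      (forall G : sgraph,
         unsat_graph G <->
         no_isolated_vertex G /\
         exists2 H, four_graphs H & topological_minor H G)
    & (forall G : sgraph, four_graphs G -> minimal_unsat_graph G)].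
Proof.
split; last exact: four_graphs_minimal.
- split; [exact: four_graphs_minimal | exact: unsat_graph_has_four_minor].
- move=> G; split=> [[unsatG minG]|[H FH isoGH]].
    have [H FH HG] := unsat_graph_has_four_minor unsatG.
    exists H => //; apply: graph_iso_sym; have [//|niso] := graph_iso_dec H G.
    by case: (minG H) => //; case: (four_graphs_minimal FH).
  have [unsatH minH] := four_graphs_minimal FH; split.
    have [V [S [simp unsat HS]]] := unsatH; exists V, S; split=> //.
    exact: graph_iso_trans HS.
  move=> K [[K' subK [f f_inj f_adj]] niso]; apply: minH; split.
    exists K' => //; have [g g_inj g_adj] := graph_iso_sub isoGH.
    by exists (g \o f) => [|x y /f_adj/g_adj //]; apply: inj_comp.
  move=> isoKH; apply: niso; apply: graph_iso_trans isoKH _; exact: graph_iso_sym.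
- move=> G; split=> [unsatG|[noiso [H FH HG]]].
    split; first by case/unsat_graphP: unsatG.
    exact: unsat_graph_has_four_minor.
  apply/unsat_graphP; split=> //.
  exact: refutable_topological_minor HG (four_graphs_refutable FH).
Qed.
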